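(* Suppose that $\sum_{n=0}^\infty a_n^{-1}<\infty$, that $a_n\to\infty$, $\beta_n\to\beta_\infty$ as $n\to\infty$ with $|\beta_\infty|>1$, and that $(k_n-1)\in\ell^1$ and $(\beta_n')\in\ell^1(\mathbb Z_+)$. Then for all $z\in\mathbb C$ the Jacobi equation has a unique solution $f_n(z)$ with the asymptotics $$f_n(z)=a_n^{-1/2}\Theta_n\big(1+o(1)\big),\qquad n\to\infty.$$ Besides, the relations $$\lim_{n\to\infty}\sqrt{a_n}\,\Theta_n\,g_n(z)=\frac{\varkappa_\infty}{2\sqrt{\beta_\infty^2-1}}\qquad\text{and}\qquad \lim_{n\to\infty}\sqrt{a_n}\,\Theta_n\,P_n(z)=-\frac{\varkappa_\infty\,\Omega(z)}{2\sqrt{\beta_\infty^2-1}}$$ are true for all $z\in\mathbb C$ with convergence uniform on compact subsets of $\mathbb C$. Moreover, if $\Omega(z)=0$, then $$\lim_{n\to\infty}\sqrt{a_n}\,\Theta_n^{-1}P_n(z)=\{P(z),g(z)\}$$ (and $\{P(z),g(z)\}\neq0$ if $\Omega(z)=0$). All functions $f_n(z)$ are analytic in $z\in\mathbb C$.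
   Context: $\mathbb Z_+=\{0,1,2,\dots\}$; $a_n>0$ and $b_n\in\mathbb R$ for $n\in\mathbb Z_+$, and $a_{-1}>0$ is an arbitrary fixed number. For a sequence $x_n$ put $x_n'=x_{n+1}-x_n$. Notation: $$\beta_n=-\frac{b_n}{2\sqrt{a_{n-1}a_n}},\quad \varkappa_n=\sqrt{\frac{a_{n+1}}{a_n}},\quad k_n=\frac{\varkappa_{n-1}}{\varkappa_n}=\frac{a_n}{\sqrt{a_{n-1}a_{n+1}}}.$$ The limit $\varkappa_\infty=\lim\varkappa_n$ exists and is finite because $(k_n-1)\in\ell^1$. The Jacobi equation is $a_{n-1}u_{n-1}+b_nu_n+a_nu_{n+1}=zu_n$, $n\in\mathbb Z_+$, for sequences $(u_n)_{n\ge-1}$. The polynomials $P_n(z)$ are its solution with $P_{-1}(z)=0$, $P_0(z)=1$. The Wronskian is $\{u,v\}=a_n(u_nv_{n+1}-u_{n+1}v_n)$, independent of $n\ge-1$ for solutions. The branch of $\sqrt{x^2-1}$ for real $|x|>1$ is positive for $x>1$ and negative for $x<-1$ (this applies to $\sqrt{\beta_\infty^2-1}$); $\zeta(x)=x-\sqrt{x^2-1}$, so $|\zeta(x)|<1$. Fix $N_0$ such that $|\beta_n|$ for $n\ge N_0$ are separated from $1$ and $\beta_n\beta_\infty>0$; put $$\Theta_n=\prod_{m=N_0}^{n-1}\zeta(\beta_m)=(\operatorname{sgn}\beta_\infty)^{n-N_0}\exp\Big(-\sum_{m=N_0}^{n-1}\operatorname{arccosh}|\beta_m|\Big).$$ $\Omega(z)=\{P(z),f(z)\}=-a_{-1}f_{-1}(z)$.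 The solution $g_n(z)$ is defined by $g_n(z)=f_n(z)\sum_{m=N_1+1}^n\big(a_{m-1}f_{m-1}(z)f_m(z)\big)^{-1}$ for $n\ge N_1+1$, where $N_1$ is such that $f_n(z)\ne0$ for $n\ge N_1$ (for a given compact set of $z$, $N_1$ is chosen common for all $z$ in it), and is extended to all $n\ge-1$ as a solution of the Jacobi equation. *)

(* Defs.v *)
From Stdlib Require Import Reals ZArith List Lra Lia.
From Coquelicot Require Import Coquelicot.

Open Scope R_scope.

(* Sequences (x_n) with n >= -1 are functions on Z of which only the values at
   n >= -1 (for the coefficients b: n >= 0) matter. *)
Coercion Z.of_nat : nat >-> Z.

Definition ell1 (x : nat -> R) : Prop := ex_series (fun n => Rabs (x n)).

Section Coefficients.

Variables a b : Z -> R.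

Definition beta (n : Z) : R := - b n / (2 * sqrt (a (n - 1)%Z * a n)).

Definition kappa (n : Z) : R := sqrt (a (n + 1)%Z / a n).

Definition kk (n : Z) : R := kappa (n - 1) / kappa n.

Definition kappa_inf : R := real (Lim_seq (fun n : nat => kappa n)).

(* For real |x| > 1: the branch of the square root of x^2 - 1 with the sign of x. *)
Definition root (x : R) : R := sign x * sqrt (x ^ 2 - 1).

Definition zeta (x : R) : R := x - root x.

Definition admissible_N0 (beta_inf : R) (N0 : nat) : Prop :=
  (exists c : R, 1 < c /\ forall n : nat, (N0 <= n)%nat -> c <= Rabs (beta n)) /\
  (forall n : nat, (N0 <= n)%nat -> 0 < beta n * beta_inf).

(* The product over N0 <= m <= n - 1; it is 1 when n <= N0. *)
Definition Theta (N0 n : nat) : R :=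
  fold_right Rmult 1 (map (fun m : nat => zeta (beta m)) (seq N0 (n - N0))).

Definition jacobi_solution (z : C) (u : Z -> C) : Prop :=
  forall n : Z, (0 <= n)%Z ->
    (a (n - 1)%Z * u (n - 1)%Z + b n * u n + a n * u (n + 1)%Z = z * u n)%C.

(* The pair (P_{n-1}(z), P_n(z)). *)
Fixpoint P_pair (z : C) (n : nat) : C * C :=
  match n with
  | O => (RtoC 0, RtoC 1)
  | S m => let (p, q) := P_pair z m in
           (q, ((z - b m) * q - a (m - 1)%Z * p) / a m)%C
  end.

Definition P (n : Z) (z : C) : C :=
  if (n <? 0)%Z then RtoC 0 else snd (P_pair z (Z.to_nat n)).

Definition wronskian_at (n : Z) (u v : Z -> C) : C :=
  (a n * (u n * v (n + 1)%Z - u (n + 1)%Z * v n))%C.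

(* For two solutions of the same equation wronskian_at does not depend on
   n >= -1, see wronskian_at_const. *)
Definition wronskian (u v : Z -> C) : C := wronskian_at (-1) u v.

Definition Omega (f : Z -> C -> C) (z : C) : C :=
  wronskian (fun n => P n z) (fun n => f n z).

Definition jost_asymptotics (N0 : nat) (u : Z -> C) : Prop :=
  exists eps : nat -> C,
    filterlim eps eventually (locally (RtoC 0)) /\
    forall n : nat, (N0 <= n)%nat ->
      u n = (RtoC (/ sqrt (a n) * Theta N0 n) * (1 + eps n))%C.

Definition second_solution (z : C) (N1 : nat) (f g : Z -> C) : Prop :=
  jacobi_solution z g /\
  forall n : nat, (N1 + 1 <= n)%nat ->
    g n = (f n * sum_n_m (fun m : nat => / (a (m - 1)%Z * f (m - 1)%Z * f m))
                   (N1 + 1) n)%C.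

End Coefficients.

Definition compact_C (K : C -> Prop) : Prop :=
  forall (I : Type) (U : I -> C -> Prop),
    (forall i, open (U i)) ->
    (forall z, K z -> exists i, U i z) ->
    exists l : list I, forall z, K z -> exists i, In i l /\ U i z.

Definition cvg_uniform_on (K : C -> Prop) (F : nat -> C -> C) (L : C -> C) : Prop :=
  forall eps : R, 0 < eps ->
    exists N : nat, forall n : nat, (N <= n)%nat ->
      forall z : C, K z -> Cmod (F n z - L z) < eps.

Definition entire (h : C -> C) : Prop :=
  forall z0 : C, exists (r : R) (c : nat -> C), 0 < r /\
    forall z : C, Cmod (z - z0) < r ->
      is_pseries (K := C_AbsRing) (V := C_NormedModule) c (z - z0)%C (h z).

Lemma P_init (a b : Z -> R) (z : C) :
  P a b (-1) z = RtoC 0 /\ P a b 0 z = RtoC 1.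
Proof. split; reflexivity. Qed.

Lemma P_solution (a b : Z -> R) (z : C) :
  (forall n : Z, (-1 <= n)%Z -> 0 < a n) ->
  jacobi_solution a b z (fun n => P a b n z).
Proof.
intros ha n hn.
assert (Ha : RtoC (a n) <> RtoC 0).
{ intros E. apply RtoC_inj in E. generalize (ha n ltac:(lia)). lra. }
rewrite <- (Z2Nat.id n hn) in Ha |- *.
generalize dependent (Z.to_nat n). clear n hn. intros m Ha.
assert (E1 : P a b (m + 1)%Z z = snd (P_pair a b z (S m))).
{ unfold P. replace (m + 1 <? 0)%Z with false
    by (symmetry; apply Z.ltb_ge; lia).
  do 2 f_equal. lia. }
assert (E0 : P a b m z = snd (P_pair a b z m)).
{ unfold P. replace (m <? 0)%Z with false
    by (symmetry; apply Z.ltb_ge; lia).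
  do 2 f_equal. lia. }
assert (E2 : P a b (m - 1)%Z z = fst (P_pair a b z m)).
{ destruct m as [|m]; [reflexivity|].
  unfold P. replace (S m - 1 <? 0)%Z with false
    by (symmetry; apply Z.ltb_ge; lia).
  replace (Z.to_nat (S m - 1)) with m by lia.
  cbn [P_pair]. destruct (P_pair a b z m); reflexivity. }
rewrite E0, E1, E2. cbn [P_pair]. destruct (P_pair a b z m) as [p q].
cbn [fst snd]. field. exact Ha.
Qed.

Lemma wronskian_at_const (a b : Z -> R) (z : C) (u v : Z -> C) :
  jacobi_solution a b z u -> jacobi_solution a b z v ->
  forall n : Z, (-1 <= n)%Z -> wronskian_at a n u v = wronskian a u v.
Proof.
intros hu hv n hn. unfold wronskian.
replace n with (-1 + Z.to_nat (n + 1))%Z by lia.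
generalize (Z.to_nat (n + 1)). clear n hn. intros m.
induction m as [|m IH]; [reflexivity|].
rewrite <- IH. clear IH.
replace (-1 + S m)%Z with (Z.of_nat m) by lia.
replace (-1 + m)%Z with (m - 1)%Z by lia.
unfold wronskian_at. replace (m - 1 + 1)%Z with (Z.of_nat m) by lia.
generalize (hu m ltac:(lia)) (hv m ltac:(lia)). intros Hu Hv.
assert (Hu' : (a m * u (m + 1)%Z = z * u m - b m * u m - a (m - 1)%Z * u (m - 1)%Z)%C)
  by (rewrite <- Hu; ring).
assert (Hv' : (a m * v (m + 1)%Z = z * v m - b m * v m - a (m - 1)%Z * v (m - 1)%Z)%C)
  by (rewrite <- Hv; ring).
transitivity (u m * (a m * v (m + 1)%Z) - (a m * u (m + 1)%Z) * v m)%C; [ring|].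
rewrite Hu', Hv'. ring.
Qed.

Lemma Omega_eq (a b : Z -> R) (f : Z -> C -> C) (z : C) :
  Omega a b f z = (- (a (-1)%Z * f (-1)%Z z))%C.
Proof.
unfold Omega, wronskian, wronskian_at.
change (P a b (-1 + 1) z) with (RtoC 1). change (P a b (-1) z) with (RtoC 0).
ring.
Qed.

(* Main.v *)
(* Put f_n = a_n^(-1/2) Theta_n u_n. Since 2 beta_n = zeta_n + 1/zeta_n with zeta_n = zeta(beta_n),
   the Jacobi equation becomes
     (u_n - u_(n+1)) - q_n (u_(n+1) - u_(n+2)) = (r_n + z s_n) u_(n+1),  q_n = zeta_n k_(n+1) zeta_(n+1),
   where r and s are summable and limsup |q_n| < 1. The left-hand side has a bounded inverse from
   summable sequences to sequences vanishing at infinity, so far enough out a Neumann series gives,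
   near every z0, a solution u_n -> 1 that is a convergent power series in z - z0; downward
   recursion extends it to all n >= -1, and the Wronskian gives uniqueness.
   A solution v with {f, v} = c satisfies v_(n+1)/f_(n+1) = v_n/f_n + c/(a_n f_n f_(n+1)), so that
   X_n = Theta_n^2 v_n/f_n obeys the stable recursion
     X_(n+1) = zeta_n^2 X_n + c zeta_n kappa_n/(u_n u_(n+1)),
   whose limit is c kappa_inf zeta/(1 - zeta^2) = c kappa_inf/(2 root(beta_inf)). Both g (c = 1) and
   P (c = -Omega) are of this kind; if Omega = 0, then P = {P, g} f for large n. *)
Require Import Defs.
From Stdlib Require Import Reals ZArith Lra Lia List ClassicalEpsilon IndefiniteDescription.
From Coquelicot Require Import Coquelicot.
Open Scope R_scope.

(** * Series and limits of complex numbers *)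

(** Dividing by Theta makes the constants solve the unperturbed equation; the price is the drift
    1/zeta_(n+1) - 1/zeta_n inside r_n, summable because the increments of beta are. The rest of r_n
    comes from k_n - 1, and s_n = zeta_n / sqrt(a_n a_(n+1)) is summable because 1/a_n is. The
    left-hand side also annihilates sequences whose differences grow like the inverse products of
    the q_n, so it is inverted by summation from n to infinity, never from the left. The obstacle is
    uniformity in z: the size of z s_n decides where the Neumann series starts to contract, so no
    index serves all z. Each z0 gets its own starting index and its own unit disc; uniqueness glues
    the local families into one f. For the same reason the limits of g and P are first proved near
    each z0, by recursions with majorants independent of z, and then passed to compact sets by a
    finite cover. *)

Definition cseries (a : nat -> C) (l : C) : Prop :=
  is_series (K := C_AbsRing) (V := C_NormedModule) a l.

Lemma clim_iff (u : nat -> C) (l : C) :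
  filterlim u eventually (locally l) <->
  forall eps : R, 0 < eps -> exists N, forall n, (N <= n)%nat -> Cmod (u n - l) < eps.
Proof.
split; intros H.
- intros eps he.
  (* Balls of [C] are products of balls of the coordinates, so the passage to [Cmod] costs a factor
     sqrt 2. *)
  assert (he' : 0 < eps / sqrt 2) by (apply Rdiv_lt_0_compat; [lra | apply sqrt_lt_R0; lra]).
  specialize (H (ball l (mkposreal _ he')) (locally_ball l (mkposreal _ he'))).
  destruct H as [N H]. exists N. intros n hn.
  generalize (C_NormedModule_mixin_compat2 l (u n) (mkposreal _ he') (H n hn)).
  simpl. intros E. change (Cmod (u n - l)%C < sqrt 2 * (eps / sqrt 2)) in E.
  replace (sqrt 2 * (eps / sqrt 2)) with eps in E; [exact E|].
  field. apply Rgt_not_eq, sqrt_lt_R0; lra.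
- intros Q [d hd]. destruct (H d (cond_pos d)) as [N hN].
  exists N. intros n hn. apply hd. apply C_NormedModule_mixin_compat1. exact (hN n hn).
Qed.

Lemma clim_unique (u : nat -> C) (l m : C) :
  filterlim u eventually (locally l) -> filterlim u eventually (locally m) -> l = m.
Proof.
rewrite !clim_iff. intros Hl Hm.
destruct (Req_dec (Cmod (l - m)) 0) as [E|E].
{ apply Cmod_eq_0 in E. replace l with (l - m + m)%C by ring. rewrite E. ring. }
assert (0 < Cmod (l - m)) by (generalize (Cmod_ge_0 (l - m)); lra).
destruct (Hl (Cmod (l - m) / 2)) as [N HN]; [lra|].
destruct (Hm (Cmod (l - m) / 2)) as [M HM]; [lra|].
specialize (HN (N + M)%nat ltac:(lia)). specialize (HM (N + M)%nat ltac:(lia)).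
generalize (Cmod_triangle (l - u (N + M)%nat) (u (N + M)%nat - m)).
replace (l - u (N + M)%nat + (u (N + M)%nat - m))%C with (l - m)%C by ring.
rewrite <- (Cmod_opp (l - u (N + M)%nat)).
replace (- (l - u (N + M)%nat))%C with (u (N + M)%nat - l)%C by ring. lra.
Qed.

Lemma ex_cseries (a : nat -> C) (b : nat -> R) :
  (forall n, Cmod (a n) <= b n) -> ex_series b -> exists l, cseries a l.
Proof.
intros H Hb.
exact (ex_series_le (K := C_AbsRing) (V := C_CompleteNormedModule) a b H Hb).
Qed.

Lemma Cmod_cseries_le (a : nat -> C) (b : nat -> R) (l : C) :
  cseries a l -> (forall n, Cmod (a n) <= b n) -> ex_series b -> Cmod l <= Series b.
Proof.
intros Ha Hab Hb. apply Rnot_lt_le. intros Hlt.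
assert (Hs : forall n, Cmod (sum_n a n) <= Series b).
{ intros n. apply Rle_trans with (sum_n b n).
  - induction n as [|n IH]; [rewrite !sum_O; apply Hab|].
    rewrite !sum_Sn. eapply Rle_trans; [apply Cmod_triangle|].
    apply Rplus_le_compat; [exact IH|apply Hab].
  - rewrite sum_n_Reals. apply sum_incr.
    + apply is_series_Reals. apply Series_correct, Hb.
    + intros k. generalize (Cmod_ge_0 (a k)) (Hab k). lra. }
destruct (proj1 (clim_iff (sum_n a) l) Ha (Cmod l - Series b)) as [N HN]; [lra|].
specialize (HN N (Nat.le_refl N)).
generalize (Cmod_triangle (sum_n a N) (l - sum_n a N)) (Hs N).
replace (sum_n a N + (l - sum_n a N))%C with l by ring.
rewrite <- (Cmod_opp (l - sum_n a N)).
replace (- (l - sum_n a N))%C with (sum_n a N - l)%C by ring. lra.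
Qed.

Lemma cseries_unique (a : nat -> C) (l m : C) : cseries a l -> cseries a m -> l = m.
Proof. apply clim_unique. Qed.

Lemma cseries_ext (a b : nat -> C) (l m : C) :
  (forall n, a n = b n) -> l = m -> cseries a l -> cseries b m.
Proof. intros H <-. exact (is_series_ext (V := C_NormedModule) a b l H). Qed.

Lemma cseries_plus (a b : nat -> C) (l m : C) :
  cseries a l -> cseries b m -> cseries (fun n => a n + b n)%C (l + m)%C.
Proof. exact (is_series_plus (V := C_NormedModule) a b l m). Qed.

Lemma cseries_scal (c : C) (a : nat -> C) (l : C) :
  cseries a l -> cseries (fun n => c * a n)%C (c * l)%C.
Proof. exact (is_series_scal (V := C_NormedModule) c a l). Qed.

Lemma cseries_minus (a b : nat -> C) (l m : C) :
  cseries a l -> cseries b m -> cseries (fun n => a n - b n)%C (l - m)%C.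
Proof. exact (is_series_minus (V := C_NormedModule) a b l m). Qed.

Lemma cseries_tail (a : nat -> C) (l : C) :
  cseries a l -> cseries (fun n => a (S n)) (l - a O)%C.
Proof.
intros H. apply (is_series_incr_1 (V := C_NormedModule) a (l - a O)%C).
revert H. apply cseries_ext; [reflexivity|]. unfold plus; simpl. ring.
Qed.

Lemma clim_iff_Cmod (u : nat -> C) (l : C) :
  filterlim u eventually (locally l) <-> is_lim_seq (fun n => Cmod (u n - l)) 0.
Proof.
rewrite clim_iff, <- is_lim_seq_spec. split; intros H.
- intros eps. destruct (H eps (cond_pos eps)) as [N HN]. exists N. intros n hn.
  rewrite Rminus_0_r, Rabs_pos_eq by apply Cmod_ge_0. auto.
- intros eps he. destruct (H (mkposreal _ he)) as [N HN]. exists N. intros n hn.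
  generalize (HN n hn). simpl. rewrite Rminus_0_r, Rabs_pos_eq by apply Cmod_ge_0. auto.
Qed.

Lemma lim_0_le (u v : nat -> R) (N : nat) :
  (forall n, (N <= n)%nat -> 0 <= u n <= v n) -> is_lim_seq v 0 -> is_lim_seq u 0.
Proof.
intros H Hv. apply (is_lim_seq_le_le_loc (fun _ => 0) u v);
  [exists N; exact H|apply is_lim_seq_const|exact Hv].
Qed.

Lemma lim_0_scal (c : R) (u : nat -> R) : is_lim_seq u 0 -> is_lim_seq (fun n => c * u n) 0.
Proof.
intros H. generalize (is_lim_seq_scal_l u c 0 H). simpl. rewrite Rmult_0_r. auto.
Qed.

Lemma lim_0_plus (u v : nat -> R) :
  is_lim_seq u 0 -> is_lim_seq v 0 -> is_lim_seq (fun n => u n + v n) 0.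
Proof. intros Hu Hv. generalize (is_lim_seq_plus' u v 0 0 Hu Hv). rewrite Rplus_0_r. auto. Qed.

Lemma lim_0_mult (u v : nat -> R) (l : R) :
  is_lim_seq u l -> is_lim_seq v 0 -> is_lim_seq (fun n => u n * v n) 0.
Proof. intros Hu Hv. generalize (is_lim_seq_mult' u v l 0 Hu Hv). rewrite Rmult_0_r. auto. Qed.

Lemma clim_ext (u v : nat -> C) (l : C) (N : nat) :
  (forall n, (N <= n)%nat -> u n = v n) ->
  filterlim u eventually (locally l) -> filterlim v eventually (locally l).
Proof. intros H. apply filterlim_ext_loc. exists N. exact H. Qed.

Lemma clim_const (l : C) : filterlim (fun _ : nat => l) eventually (locally l).
Proof. apply filterlim_const. Qed.

Lemma Cmod_mult_sub_le (x y l m : C) :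
  Cmod (x * y - l * m) <= Cmod (x - l) * Cmod (y - m) + Cmod l * Cmod (y - m) + Cmod m * Cmod (x - l).
Proof.
replace (x * y - l * m)%C with ((x - l) * (y - m) + l * (y - m) + m * (x - l))%C by ring.
eapply Rle_trans; [apply Cmod_triangle|]. rewrite Cmod_mult.
apply Rplus_le_compat_r. eapply Rle_trans; [apply Cmod_triangle|]. rewrite !Cmod_mult. lra.
Qed.

Lemma clim_mult (u v : nat -> C) (l m : C) :
  filterlim u eventually (locally l) -> filterlim v eventually (locally m) ->
  filterlim (fun n => u n * v n)%C eventually (locally (l * m)%C).
Proof.
rewrite !clim_iff_Cmod. intros Hu Hv.
refine (lim_0_le _ _ O (fun n _ => conj (Cmod_ge_0 _) (Cmod_mult_sub_le (u n) (v n) l m)) _).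
apply lim_0_plus; [apply lim_0_plus|]; try (apply lim_0_scal; assumption).
apply lim_0_mult with 0; assumption.
Qed.

Lemma clim_incr_1 (u : nat -> C) (l : C) :
  filterlim u eventually (locally l) -> filterlim (fun n => u (S n)) eventually (locally l).
Proof. rewrite !clim_iff_Cmod. intros H. apply (is_lim_seq_incr_1 (fun n => Cmod (u n - l))), H. Qed.

Lemma clim_scal (c : C) (u : nat -> C) (l : C) :
  filterlim u eventually (locally l) -> filterlim (fun n => c * u n)%C eventually (locally (c * l)%C).
Proof. apply clim_mult, clim_const. Qed.

Lemma Cmult_eq_reg_l (c x y : C) : (c * x = c * y)%C -> c <> RtoC 0 -> x = y.
Proof.
intros E hc. replace x with (/ c * (c * x))%C by (field; exact hc). rewrite E. field. exact hc.
Qed.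

(** * Summable perturbations of a second-order difference equation *)

(** Dependent choice with an invariant that may depend on the index. It builds the Neumann terms and
    the power series coefficients, each of which exists only through an existence statement about
    its predecessor together with a bound depending on [k]. *)
Lemma dependent_sequence (X : Type) (P : nat -> X -> Prop) (S' : X -> X -> Prop) :
  (exists x, P O x) -> (forall k x, P k x -> exists y, P (S k) y /\ S' x y) ->
  exists s : nat -> X, forall k, P k (s k) /\ S' (s k) (s (S k)).
Proof.
intros [x0 H0] Hstep.
destruct (functional_choice (fun (kx : nat * X) y => P (fst kx) (snd kx) ->
    P (S (fst kx)) y /\ S' (snd kx) y)) as [F HF].
{ intros [k x]; simpl. destruct (excluded_middle_informative (P k x)) as [H|H].
  - destruct (Hstep k x H) as [y Hy]. exists y. auto.
  - exists x. tauto. }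
set (s := fix s k := match k with O => x0 | S k => F (k, s k) end).
assert (Hs : forall k, P k (s k)).
{ induction k as [|k IH]; [exact H0|]. apply (HF (k, s k) IH). }
exists s. intros k. split; [apply Hs|]. apply (HF (k, s k) (Hs k)).
Qed.

Definition summable (h : nat -> C) : Prop := ex_series (fun n => Cmod (h n)).

Definition tail_sum (h : nat -> C) (n : nat) : R := Series (fun d => Cmod (h (n + d)%nat)).

Lemma summable_shift (h : nat -> C) (n : nat) :
  summable h -> summable (fun d => h (n + d)%nat).
Proof. intros H. exact (proj1 (ex_series_incr_n (fun m => Cmod (h m)) n) H). Qed.

Lemma summable_le (h : nat -> C) (r : nat -> R) :
  (forall n, Cmod (h n) <= r n) -> ex_series r -> summable h.
Proof.
intros H Hr. apply (ex_series_le (K := R_AbsRing) (V := R_CompleteNormedModule) _ r); [|exact Hr].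
intros n. change (Rabs (Cmod (h n)) <= r n).
rewrite Rabs_pos_eq; [apply H|apply Cmod_ge_0].
Qed.

Lemma tail_ge_0 (h : nat -> C) (n : nat) : summable h -> 0 <= tail_sum h n.
Proof.
intros H. unfold tail_sum.
rewrite <- (Rmult_0_l (Series (fun d => Cmod (h (n + d)%nat)))), <- Series_scal_l.
apply Series_le; [|apply (summable_shift h n H)].
intros d. generalize (Cmod_ge_0 (h (n + d)%nat)). lra.
Qed.

Lemma tail_S (h : nat -> C) (n : nat) : summable h -> tail_sum h n = Cmod (h n) + tail_sum h (S n).
Proof.
intros H. unfold tail_sum. rewrite Series_incr_1; [|apply (summable_shift h n H)].
rewrite Nat.add_0_r. f_equal. apply Series_ext. intros d. do 2 f_equal. lia.
Qed.

Lemma tail_decr (h : nat -> C) (n : nat) : summable h -> tail_sum h n <= tail_sum h O.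
Proof.
intros H. induction n as [|n IH]; [lra|].
generalize (tail_S h n H) (Cmod_ge_0 (h n)). lra.
Qed.

Lemma tail_lim (h : nat -> C) : summable h -> is_lim_seq (tail_sum h) 0.
Proof.
intros H.
set (u := fun n => Cmod (h n)).
assert (E : forall n, tail_sum h (S n) = Series u - sum_n u n).
{ intros n. unfold tail_sum. rewrite (Series_incr_n u (S n)); [|lia|exact H].
  simpl pred. rewrite <- sum_n_Reals. unfold u. ring. }
apply is_lim_seq_incr_1.
apply is_lim_seq_ext with (fun n => Series u - sum_n u n); [intros n; symmetry; apply E|].
replace 0 with (Series u - Series u) by ring.
apply is_lim_seq_minus'; [apply is_lim_seq_const|].
apply Series_correct, H.
Qed.

Lemma summable_scaled (h r : nat -> C) (c : R) :
  (forall n, Cmod (h n) <= c * Cmod (r n)) -> summable r -> summable h.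
Proof.
intros H Hr. apply summable_le with (1 := H).
apply (ex_series_scal_l (K := R_AbsRing) c (fun n => Cmod (r n)) Hr).
Qed.

Lemma tail_scaled (h r : nat -> C) (c : R) (n : nat) :
  (forall m, (n <= m)%nat -> Cmod (h m) <= c * Cmod (r m)) -> summable r ->
  tail_sum h n <= c * tail_sum r n.
Proof.
intros H Hr. unfold tail_sum. rewrite <- Series_scal_l. apply Series_le.
- intros d. split; [apply Cmod_ge_0|apply H; lia].
- apply (ex_series_scal_l (K := R_AbsRing) c (fun d => Cmod (r (n + d)%nat))), (summable_shift r n Hr).
Qed.

Section Perturbation.

Variables (Q : nat -> R) (q : R).
Hypotheses (q_ge_0 : 0 <= q) (q_lt_1 : q < 1) (Q_le : forall n, Rabs (Q n) <= q).

(** With y_n = x_n - x_(n+1) this is the first-order expression y_n - Q_n y_(n+1). Constants are in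
    the kernel, so a solution tending to 1 is sought as 1 plus a decaying term. *)
Definition second_diff (x : nat -> C) (n : nat) : C :=
  (x n - x (S n) - Q n * (x (S n) - x (S (S n))))%C.

Fixpoint green_diff (n d : nat) : R :=
  match d with O => 1 | S d => Q n * green_diff (S n) d end.

(* Kernel of the inverse of second_diff on sequences vanishing at infinity:
   second_diff x = g for x n = sum_d green n d * g (n + d), and then
   x n - x (n + 1) = sum_d green_diff n d * g (n + d). *)
Fixpoint green (n d : nat) : R :=
  match d with O => 1 | S d' => green_diff n d + green (S n) d' end.

Lemma green_diff_le (n d : nat) : Rabs (green_diff n d) <= q ^ d.
Proof.
revert n. induction d as [|d IH]; intros n; simpl; [rewrite Rabs_R1; lra|].
rewrite Rabs_mult. apply Rmult_le_compat; auto using Rabs_pos.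
Qed.

Lemma green_le (n d : nat) : Rabs (green n d) <= / (1 - q).
Proof.
(* The bound [/ (1 - q)] does not pass through the induction; the exact partial geometric sum
   does. *)
apply Rle_trans with ((1 - q ^ S d) / (1 - q)).
- revert n. induction d as [|d IH]; intros n.
  + simpl. rewrite Rabs_R1. right. field. lra.
  + change (green n (S d)) with (green_diff n (S d) + green (S n) d).
    eapply Rle_trans; [apply Rabs_triang|].
    eapply Rle_trans; [apply Rplus_le_compat; [apply green_diff_le|apply IH]|].
    right. simpl. field. lra.
- unfold Rdiv. rewrite <- (Rmult_1_l (/ (1 - q))) at 2.
  apply Rmult_le_compat_r; [left; apply Rinv_0_lt_compat; lra|].
  generalize (pow_le q (S d) q_ge_0). lra.
Qed.

Lemma second_diff_inverse (g : nat -> C) :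
  summable g -> exists x : nat -> C,
    (forall n, second_diff x n = g n) /\
    forall n, Cmod (x n) <= / (1 - q) * tail_sum g n.
Proof.
intros Hg.
assert (bnd : forall n d, Cmod (green n d * g (n + d)%nat)%C <= / (1 - q) * Cmod (g (n + d)%nat)).
{ intros n d. rewrite Cmod_mult, Cmod_R.
  apply Rmult_le_compat_r; [apply Cmod_ge_0|apply green_le]. }
assert (bndd : forall n d, Cmod (green_diff n d * g (n + d)%nat)%C <= 1 * Cmod (g (n + d)%nat)).
{ intros n d. rewrite Cmod_mult, Cmod_R.
  apply Rmult_le_compat_r; [apply Cmod_ge_0|].
  apply Rle_trans with (1 := green_diff_le n d). rewrite <- (pow1 d). apply pow_incr. lra. }
assert (es : forall c n, ex_series (fun d => c * Cmod (g (n + d)%nat))).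
{ intros c n. apply (ex_series_scal_l (K := R_AbsRing) c (fun d => Cmod (g (n + d)%nat))), (summable_shift g n Hg). }
destruct (functional_choice (fun n x => cseries (fun d => green n d * g (n + d)%nat)%C x)) as [x Hx].
{ intros n. apply ex_cseries with (1 := bnd n), es. }
destruct (functional_choice (fun n y => cseries (fun d => green_diff n d * g (n + d)%nat)%C y)) as [y Hy].
{ intros n. apply ex_cseries with (1 := bndd n), es. }
(* Splitting off the term d = 0 turns the recursion of [green_diff] into this relation, and below
   that of [green] into [Ex]. *)
assert (Ey : forall n, y n = (g n + Q n * y (S n))%C).
{ intros n. generalize (cseries_tail _ _ (Hy n)) (cseries_scal (Q n) _ _ (Hy (S n))).
  intros H1 H2.
  assert (E : (y n - green_diff n 0 * g (n + 0)%nat = Q n * y (S n))%C).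
  { refine (cseries_unique _ _ _ H1 _). refine (cseries_ext _ _ _ _ _ eq_refl H2).
    intros d. cbn [green_diff]. rewrite RtoC_mult. replace (n + S d)%nat with (S n + d)%nat by lia. ring. }
  rewrite Nat.add_0_r in E. rewrite <- E. cbn [green_diff]. ring. }
assert (Ex : forall n, (x n - x (S n))%C = y n).
{ intros n. generalize (cseries_tail _ _ (Hx n)) (cseries_tail _ _ (Hy n)) (Hx (S n)).
  intros H1 H2 H3.
  assert (E : (x n - green n 0 * g (n + 0)%nat = (y n - green_diff n 0 * g (n + 0)%nat) + x (S n))%C).
  { refine (cseries_unique _ _ _ H1 _). refine (cseries_ext _ _ _ _ _ eq_refl (cseries_plus _ _ _ _ H2 H3)).
    intros d. change (green n (S d)) with (green_diff n (S d) + green (S n) d).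
    rewrite RtoC_plus. replace (n + S d)%nat with (S n + d)%nat by lia. ring. }
  cbn [green green_diff] in E.
  replace (x n) with ((x n - 1 * g (n + 0)%nat) + 1 * g (n + 0)%nat)%C by ring.
  rewrite E. ring. }
exists x. split.
- intros n. unfold second_diff. rewrite !Ex, Ey. ring.
- intros n. unfold tail_sum. rewrite <- Series_scal_l.
  apply Cmod_cseries_le with (1 := Hx n) (2 := bnd n), es.
Qed.

Lemma geom_half : is_series (fun k => (/ 2) ^ k) 2.
Proof.
generalize (is_series_geom (/ 2)). replace (/ (1 - / 2)) with 2 by field.
intros H. apply H. rewrite Rabs_pos_eq; lra.
Qed.

Lemma Series_geom_half (c : R) :
  ex_series (fun k => (/ 2) ^ k * c) /\ Series (fun k => (/ 2) ^ k * c) = 2 * c.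
Proof.
assert (H : is_series (fun k => (/ 2) ^ k * c) (2 * c)) by apply is_series_scal_r, geom_half.
split; [eexists; exact H|apply is_series_unique, H].
Qed.

Lemma second_diff_cseries (xs : nat -> nat -> C) (x : nat -> C) (n : nat) :
  (forall m, cseries (fun k => xs k m) (x m)) ->
  cseries (fun k => second_diff (xs k) n) (second_diff x n).
Proof.
intros H. unfold second_diff.
apply cseries_minus; [apply cseries_minus; apply H|].
apply cseries_scal. apply cseries_minus; apply H.
Qed.

(* Neumann series: x = sum_k x_k with second_diff x_0 = g and
   second_diff x_(k+1) n = r n * x_k (n + 1); the smallness of r makes |x_k| = O(2^-k). *)
Lemma second_diff_resolvent (r g : nat -> C) :
  summable r -> / (1 - q) * tail_sum r 0 <= / 2 -> summable g ->
  exists x : nat -> C,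
    (forall n, second_diff x n = (r n * x (S n) + g n)%C) /\
    forall n, Cmod (x n) <= 2 * (/ (1 - q) * tail_sum g n).
Proof.
intros Hr Hsmall Hg.
assert (Kpos : 0 < / (1 - q)) by (apply Rinv_0_lt_compat; lra).
set (K := / (1 - q)) in *.
assert (Hpos : forall n, 0 <= K * tail_sum g n)
  by (intros n; apply Rmult_le_pos; [lra|apply tail_ge_0, Hg]).
assert (Hdec : forall n m, (n <= m)%nat -> K * tail_sum g m <= K * tail_sum g n).
{ intros n m h. apply Rmult_le_compat_l; [lra|]. induction h; [lra|].
  generalize (tail_S g m Hg) (Cmod_ge_0 (g m)). lra. }
(* The clause for [k = O] keeps the equation of the initial term, which the step relation alone
   would lose. *)
destruct (dependent_sequence (nat -> C)
  (fun k x => (forall n, Cmod (x n) <= (/ 2) ^ k * (K * tail_sum g n)) /\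
              (k = O -> forall n, second_diff x n = g n))
  (fun x y => forall n, second_diff y n = (r n * x (S n))%C)) as [xs Hxs].
- destruct (second_diff_inverse g Hg) as [x [H1 H2]]. exists x. split; [|auto].
  intros n. rewrite pow_O, Rmult_1_l. apply H2.
- intros k x [Hb _].
  set (B := (/ 2) ^ k).
  assert (HB : 0 <= B) by (apply pow_le; lra).
  (* Beyond [n] the previous term is bounded by the tail of g at [n] itself. This factor comes out
     of the tail of the product, so the decay in [n] survives every iteration. *)
  assert (Hle : forall n m, (n <= m)%nat -> Cmod (r m * x (S m))%C <= (B * (K * tail_sum g n)) * Cmod (r m)).
  { intros n m h. rewrite Cmod_mult, Rmult_comm. apply Rmult_le_compat_r; [apply Cmod_ge_0|].
    apply Rle_trans with (1 := Hb (S m)). apply Rmult_le_compat_l; [exact HB|]. apply Hdec. lia. }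
  destruct (second_diff_inverse (fun n => r n * x (S n))%C) as [y [H1 H2]].
  { apply summable_scaled with (r := r) (c := B * (K * tail_sum g 0)); [|exact Hr].
    intros n. apply Hle. lia. }
  exists y. split; [split; [|discriminate]|exact H1].
  intros n. apply Rle_trans with (1 := H2 n). fold K.
  apply Rle_trans with (K * ((B * (K * tail_sum g n)) * tail_sum r n)).
  { apply Rmult_le_compat_l; [lra|]. apply tail_scaled; [apply Hle|exact Hr]. }
  replace (K * (B * (K * tail_sum g n) * tail_sum r n)) with (K * tail_sum r n * (B * (K * tail_sum g n))) by ring.
  apply Rle_trans with (/ 2 * (B * (K * tail_sum g n))); [|right; unfold B; simpl; ring].
  apply Rmult_le_compat_r.
  { apply Rmult_le_pos; [exact HB|apply Hpos]. }
  apply Rle_trans with (2 := Hsmall). apply Rmult_le_compat_l; [lra|apply tail_decr, Hr].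
- destruct (functional_choice (fun n x => cseries (fun k => xs k n) x)) as [x Hx].
  { intros n. apply ex_cseries with (b := fun k => (/ 2) ^ k * (K * tail_sum g n)); [|apply Series_geom_half].
    intros k. apply (Hxs k). }
  exists x. split.
  + intros n.
    (* The terms k >= 1 of the series for [second_diff x n] are [r n] times the terms k >= 0 of the
       series for [x (S n)]. *)
    generalize (cseries_tail _ _ (second_diff_cseries xs x n Hx)).
    rewrite (proj2 (proj1 (Hxs O)) eq_refl). intros H1.
    generalize (cseries_scal (r n) _ _ (Hx (S n))). intros H2.
    assert (E : (second_diff x n - g n = r n * x (S n))%C).
    { refine (cseries_unique _ _ _ H1 _). refine (cseries_ext _ _ _ _ _ eq_refl H2).
      intros k. symmetry. apply (Hxs k). }
    rewrite <- E. ring.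
  + intros n. rewrite <- (proj2 (Series_geom_half (K * tail_sum g n))).
    apply Cmod_cseries_le with (1 := Hx n); [|apply Series_geom_half].
    intros k. apply (Hxs k).
Qed.

Lemma summable_plus_scal (r s : nat -> C) (t : C) :
  summable r -> summable s -> summable (fun n => r n + t * s n)%C.
Proof.
intros Hr Hs. apply summable_le with (fun n => plus (Cmod (r n)) (Cmod t * Cmod (s n))).
- intros n. rewrite <- Cmod_mult. apply Cmod_triangle.
- apply (ex_series_plus (K := R_AbsRing) (V := R_NormedModule)); [exact Hr|].
  apply (ex_series_scal_l (K := R_AbsRing) (Cmod t) (fun n => Cmod (s n)) Hs).
Qed.

Lemma Cmod_pow_n (t : C) (j : nat) : Cmod (pow_n (K := C_Ring) t j) = Cmod t ^ j.
Proof.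
induction j as [|j IH]; [apply Cmod_1|].
change (Cmod (t * pow_n (K := C_Ring) t j) = Cmod t ^ S j). rewrite Cmod_mult, IH. reflexivity.
Qed.

Lemma Cmod_pow_n_le (t : C) (j : nat) : Cmod t <= 1 -> Cmod (pow_n (K := C_Ring) t j) <= 1.
Proof.
intros Ht. rewrite Cmod_pow_n, <- (pow1 j). apply pow_incr. split; [apply Cmod_ge_0|exact Ht].
Qed.

(* U n t = sum_j t^j c_j n, where c_0 solves the equation for t = 0 and c_(j+1) is obtained
   from s * c_j by the resolvent of the equation for t = 0; the smallness of s gives
   |c_j| = O(2^-j), hence analyticity for |t| < 1. *)
Lemma perturbed_solution (r s : nat -> C) :
  summable r -> summable s ->
  / (1 - q) * tail_sum r 0 <= / 2 -> / (1 - q) * tail_sum s 0 <= / 4 ->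
  exists (c : nat -> nat -> C) (U : nat -> C -> C) (tau : nat -> R),
    is_lim_seq tau 0 /\
    forall t : C, Cmod t < 1 -> forall n,
      is_pseries (K := C_AbsRing) (V := C_NormedModule) (fun j => c j n) t (U n t) /\
      second_diff (fun m => U m t) n = ((r n + t * s n) * U (S n) t)%C /\
      Cmod (U n t - 1) <= tau n.
Proof.
intros Hr Hs Sr Ss.
assert (Kpos : 0 < / (1 - q)) by (apply Rinv_0_lt_compat; lra).
set (K := / (1 - q)) in *.
assert (Hsm : forall (h : nat -> C) e n, summable h -> K * tail_sum h 0 <= e -> K * tail_sum h n <= e).
{ intros h e n Hh He. apply Rle_trans with (2 := He). apply Rmult_le_compat_l; [lra|apply tail_decr, Hh]. }
assert (hp0 : forall k, 0 <= (/ 2) ^ k) by (intros; apply pow_le; lra).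
(* The bound 2 at k = 0 is 1 + 2 (1/2), from the smallness of r; the ratio 1/2 is 2 (1/4), from that
   of s. The step relation, linear in a bound [B] of the previous coefficient, still contains
   [tail_sum s n] and so gives the coefficients of positive order their decay in n. *)
destruct (dependent_sequence (nat -> C)
  (fun k x => (forall n, Cmod (x n) <= (/ 2) ^ k * 2) /\
              (k = O -> forall n, second_diff x n = (r n * x (S n))%C /\
                                   Cmod (x n - 1) <= 2 * (K * tail_sum r n)))
  (fun x y => (forall n, second_diff y n = (r n * y (S n) + s n * x (S n))%C) /\
     forall (B : R), (forall n, Cmod (x n) <= B) -> forall n, Cmod (y n) <= B * (2 * (K * tail_sum s n)))) as [c Hc].
- destruct (second_diff_resolvent r r Hr Sr Hr) as [x [H1 H2]].
  (* Adding 1 does not change [second_diff], so a solution with source r becomes a solution of the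
     homogeneous equation. *)
  exists (fun n => 1 + x n)%C. split.
  + intros n. rewrite pow_O. eapply Rle_trans; [apply Cmod_triangle|].
    rewrite Cmod_1. generalize (H2 n) (Hsm r _ n Hr Sr). fold K. lra.
  + intros _ n. split.
    * replace (r n * (1 + x (S n)))%C with (r n * x (S n) + r n)%C by ring.
      rewrite <- H1. unfold second_diff. ring.
    * replace (1 + x n - 1)%C with (x n) by ring. apply H2.
- intros k x [Hb _].
  assert (Hle : forall B, (forall n, Cmod (x n) <= B) -> forall m, Cmod (s m * x (S m))%C <= B * Cmod (s m)).
  { intros B HB m. rewrite Cmod_mult, Rmult_comm. apply Rmult_le_compat_r; [apply Cmod_ge_0|apply HB]. }
  destruct (second_diff_resolvent r (fun n => s n * x (S n))%C Hr Sr) as [y [H1 H2]].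
  { apply summable_scaled with (r := s) (2 := Hs) (c := (/ 2) ^ k * 2). apply (Hle _ Hb). }
  assert (H3 : forall (B : R), (forall n, Cmod (x n) <= B) -> forall n, Cmod (y n) <= B * (2 * (K * tail_sum s n))).
  { intros B HB n. apply Rle_trans with (1 := H2 n). fold K.
    replace (B * (2 * (K * tail_sum s n))) with (2 * (K * (B * tail_sum s n))) by ring.
    apply Rmult_le_compat_l; [lra|]. apply Rmult_le_compat_l; [lra|].
    apply tail_scaled; [|exact Hs]. intros m _. apply Hle, HB. }
  exists y. split; [split; [|discriminate]|split; [exact H1|exact H3]].
  intros n. apply Rle_trans with (1 := H3 _ Hb n). simpl.
  generalize (Hsm s _ n Hs Ss) (hp0 k). intros A1 A2.
  apply Rle_trans with ((/ 2) ^ k * 2 * / 2); [|lra].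
  apply Rmult_le_compat_l; lra.
- assert (Htb : forall t, Cmod t < 1 -> forall n j,
    Cmod (pow_n (K := C_Ring) t j * c j n)%C <= (/ 2) ^ j * 2).
  { intros t Ht n j. rewrite Cmod_mult. generalize (Cmod_pow_n_le t j ltac:(lra)) (proj1 (proj1 (Hc j)) n).
    intros A1 A2. rewrite <- (Rmult_1_l ((/ 2) ^ j * 2)). apply Rmult_le_compat; auto using Cmod_ge_0. }
  (* Outside the unit disc the value is arbitrary. *)
  destruct (functional_choice (fun (nt : nat * C) y => Cmod (snd nt) < 1 ->
     cseries (fun j => pow_n (K := C_Ring) (snd nt) j * c j (fst nt))%C y)) as [U HU].
  { intros [n t]; simpl. destruct (Rlt_dec (Cmod t) 1) as [Ht|Ht]; [|exists (RtoC 0); tauto].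
    destruct (ex_cseries _ _ (Htb t Ht n)) as [l Hl]; [apply Series_geom_half|]. exists l; auto. }
  (* The first summand bounds c_0 n - 1. The second bounds the rest of the series: its term j + 1 is
     at most 2^(-j) times [2 * (2 * (K * tail_sum s n))], and the geometric series doubles this. *)
  exists c, (fun n t => U (n, t)), (fun n => 2 * (K * tail_sum r n) + 2 * (2 * (2 * (K * tail_sum s n)))). split.
  { replace (Finite 0) with (Finite (2 * (K * 0) + 2 * (2 * (2 * (K * 0))))) by (f_equal; ring).
    apply (is_lim_seq_plus' _ _ _ _);
      repeat (apply (is_lim_seq_scal_l _ _ (Finite _))); apply tail_lim; assumption. }
  intros t Ht n.
  assert (HUn : forall n, cseries (fun j => pow_n (K := C_Ring) t j * c j n)%C (U (n, t)))
    by (intros m; apply (HU (m, t) Ht)).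
  split; [apply HUn|]. split.
  + generalize (cseries_tail _ _ (second_diff_cseries (fun j m => pow_n (K := C_Ring) t j * c j m)%C
      (fun m => U (m, t)) n HUn)). intros H1.
    generalize (cseries_tail _ _ (cseries_scal (r n) _ _ (HUn (S n))))
               (cseries_scal (t * s n)%C _ _ (HUn (S n))). intros H2 H3.
    generalize (cseries_plus _ _ _ _ H2 H3). intros H4.
    assert (E : (second_diff (fun m => U (m, t)) n
        - second_diff (fun m => pow_n (K := C_Ring) t 0 * c 0%nat m) n =
      r n * U (S n, t) - r n * (pow_n (K := C_Ring) t 0 * c 0%nat (S n)) + t * s n * U (S n, t))%C).
    { refine (cseries_unique _ _ _ H1 _). refine (cseries_ext _ _ _ _ _ eq_refl H4).
      intros j. symmetry.
      transitivity (pow_n (K := C_Ring) t (S j) * second_diff (c (S j)) n)%C; [unfold second_diff; ring|].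
      rewrite (proj1 (proj2 (Hc j)) n).
      change (pow_n (K := C_Ring) t (S j)) with (t * pow_n (K := C_Ring) t j)%C. ring. }
    assert (E0 : second_diff (fun m : nat => pow_n (K := C_Ring) t 0 * c 0%nat m)%C n = (r n * (pow_n (K := C_Ring) t 0 * c 0%nat (S n)))%C).
    { change (pow_n (K := C_Ring) t 0) with (RtoC 1).
      transitivity (second_diff (c O) n); [unfold second_diff; ring|].
      rewrite (proj1 (proj2 (proj1 (Hc O)) eq_refl n)). ring. }
    rewrite E0 in E.
    replace (second_diff (fun m => U (m, t)) n) with
      (second_diff (fun m => U (m, t)) n - r n * (pow_n (K := C_Ring) t 0 * c 0%nat (S n)) +
        r n * (pow_n (K := C_Ring) t 0 * c 0%nat (S n)))%C by ring.
    rewrite E. ring.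
  + generalize (cseries_tail _ _ (HUn n)). intros H1.
    replace (U (n, t) - 1)%C with ((c O n - 1) + (U (n, t) - pow_n (K := C_Ring) t 0 * c O n))%C
      by (change (pow_n (K := C_Ring) t 0) with (RtoC 1); ring).
    eapply Rle_trans; [apply Cmod_triangle|]. apply Rplus_le_compat.
    * apply (proj2 (proj1 (Hc O)) eq_refl n).
    * rewrite <- (proj2 (Series_geom_half (2 * (2 * (K * tail_sum s n))))).
      apply Cmod_cseries_le with (1 := H1); [|apply Series_geom_half].
      intros j. rewrite Cmod_mult.
      generalize (Cmod_pow_n_le t (S j) ltac:(lra)) (proj2 (proj2 (Hc j)) _ (proj1 (proj1 (Hc j))) n).
      intros A1 A2. replace ((/ 2) ^ j * (2 * (2 * (K * tail_sum s n)))) with (1 * ((/ 2) ^ j * 2 * (2 * (K * tail_sum s n)))) by ring.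
      apply Rmult_le_compat; auto using Cmod_ge_0.
Qed.

End Perturbation.

(** * Analyticity and compactness *)

Definition analytic_at (h : C -> C) (z0 : C) : Prop :=
  exists (r : R) (c : nat -> C), 0 < r /\
    forall z : C, Cmod (z - z0) < r ->
      is_pseries (K := C_AbsRing) (V := C_NormedModule) c (z - z0)%C (h z).

(** The shape of the backward Jacobi recursion. Since z - e = (z - z0) + (z0 - e), multiplication by
    it is a shift plus a multiple of the coefficients, and no product of power series is needed. *)
Lemma analytic_at_three_term (f1 f2 h : C -> C) (z0 s e d : C) :
  analytic_at f1 z0 -> analytic_at f2 z0 ->
  (forall z, h z = s * ((z - e) * f1 z - d * f2 z))%C -> analytic_at h z0.
Proof.
intros [r1 [c1 [hr1 H1]]] [r2 [c2 [hr2 H2]]] E.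
exists (Rmin r1 r2), (fun j => s * (match j with O => 0 | S j => c1 j end + (z0 - e) * c1 j - d * c2 j))%C.
split; [apply Rmin_glb_lt; assumption|].
intros z hz.
assert (P1 := H1 z (Rlt_le_trans _ _ _ hz (Rmin_l _ _))).
assert (P2 := H2 z (Rlt_le_trans _ _ _ hz (Rmin_r _ _))).
assert (P0 := is_pseries_incr_1 (K := C_AbsRing) (V := C_NormedModule) _ _ _ P1).
set (t := (z - z0)%C) in *.
change (cseries (fun j => pow_n (K := C_Ring) t j * c1 j)%C (f1 z)) in P1.
change (cseries (fun j => pow_n (K := C_Ring) t j * c2 j)%C (f2 z)) in P2.
change (cseries (fun j => pow_n (K := C_Ring) t j * PS_incr_1 (V := C_NormedModule) c1 j)%C (t * f1 z)%C) in P0.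
generalize (cseries_scal s _ _ (cseries_minus _ _ _ _
  (cseries_plus _ _ _ _ P0 (cseries_scal (z0 - e) _ _ P1)) (cseries_scal d _ _ P2))).
apply cseries_ext.
- intros [|j]; simpl PS_incr_1.
  + change (zero : C_NormedModule) with (RtoC 0).
    change (s * (pow_n (K := C_Ring) t 0 * 0 + (z0 - e) * (pow_n (K := C_Ring) t 0 * c1 O) - d * (pow_n (K := C_Ring) t 0 * c2 O)) =
      pow_n (K := C_Ring) t 0 * (s * (0 + (z0 - e) * c1 O - d * c2 O)))%C. ring.
  + change (s * (pow_n (K := C_Ring) t (S j) * c1 j + (z0 - e) * (pow_n (K := C_Ring) t (S j) * c1 (S j)) - d * (pow_n (K := C_Ring) t (S j) * c2 (S j))) =
      pow_n (K := C_Ring) t (S j) * (s * (c1 j + (z0 - e) * c1 (S j) - d * c2 (S j))))%C. ring.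
- rewrite E. unfold t. ring.
Qed.

Lemma cseries_bounded (a : nat -> C) (l : C) : cseries a l -> exists M, forall n, Cmod (a n) <= M.
Proof.
intros H.
destruct (filterlim_bounded (K := C_AbsRing) (V := C_NormedModule) (sum_n a) (ex_intro _ l H)) as [M HM].
change (forall n, Cmod (sum_n a n) <= M) in HM.
exists (M + M). intros [|n].
- generalize (HM O) (Cmod_ge_0 (sum_n a O)). rewrite sum_O. lra.
- generalize (HM (S n)) (HM n). rewrite sum_Sn. intros A1 A2.
  replace (a (S n)) with (plus (sum_n a n) (a (S n)) + - sum_n a n)%C
    by (change (plus (sum_n a n) (a (S n))) with (sum_n a n + a (S n))%C; ring).
  eapply Rle_trans; [apply Cmod_triangle|]. rewrite Cmod_opp. lra.
Qed.

(** Convergence at z0 + p with p = r / 2 bounds the terms |c_j| p^j by some M. For |z - z0| = m p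
    with m <= 1/2 the series without its constant term is then at most the sum of m^(j+1) M, hence
    at most 2 m M. *)
Lemma analytic_at_continuous (h : C -> C) (z0 : C) : analytic_at h z0 ->
  forall eps, 0 < eps -> exists r, 0 < r /\ forall z, Cmod (z - z0) < r -> Cmod (h z - h z0) < eps.
Proof.
intros [r [c [hr H]]] eps heps.
set (p := r / 2). assert (hp : 0 < p) by (unfold p; lra).
assert (Hp : Cmod (RtoC p) = p) by (rewrite Cmod_R; apply Rabs_pos_eq; lra).
assert (P : cseries (fun j => pow_n (K := C_Ring) (RtoC p) j * c j)%C (h (z0 + p)%C)).
{ generalize (H (z0 + p)%C). replace (z0 + p - z0)%C with (RtoC p) by ring.
  intros P. apply P. rewrite Hp. unfold p. lra. }
destruct (cseries_bounded _ _ P) as [M HM].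
assert (hM : 0 <= M) by (apply Rle_trans with (2 := HM O), Cmod_ge_0).
assert (H0 : h z0 = c O).
{ assert (P0 := H z0). replace (z0 - z0)%C with (RtoC 0) in P0 by ring. rewrite Cmod_0 in P0.
  specialize (P0 hr). change (cseries (fun j => pow_n (K := C_Ring) (RtoC 0) j * c j)%C (h z0)) in P0.
  apply (cseries_tail _ _) in P0.
  change (pow_n (K := C_Ring) (RtoC 0) 0) with (RtoC 1) in P0.
  (* At z = z0 the series without its constant term equals 0 times itself, so its sum is 0. *)
  assert (Z := cseries_scal 0 _ _ P0).
  assert (E : (h z0 - 1 * c O = 0 * (h z0 - 1 * c O))%C).
  { refine (cseries_unique _ _ _ P0 _). refine (cseries_ext _ _ _ _ _ eq_refl Z).
    intros j. change (pow_n (K := C_Ring) (RtoC 0) (S j)) with (0 * pow_n (K := C_Ring) (RtoC 0) j)%C. ring. }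
  replace (h z0) with (h z0 - 1 * c O + 1 * c O)%C by ring. rewrite E. ring. }
exists (Rmin (p / 2) (eps * p / (2 * (M + 1)))).
assert (hq : 0 < eps * p / (2 * (M + 1))).
{ apply Rdiv_lt_0_compat; [apply Rmult_lt_0_compat; lra|lra]. }
split; [apply Rmin_glb_lt; lra|].
intros z hz.
set (t := (z - z0)%C) in *.
assert (ht1 : Cmod t < p / 2) by (apply Rlt_le_trans with (1 := hz), Rmin_l).
assert (ht2 : Cmod t < eps * p / (2 * (M + 1))) by (apply Rlt_le_trans with (1 := hz), Rmin_r).
assert (Pz : cseries (fun j => pow_n (K := C_Ring) t j * c j)%C (h z)) by (apply H; fold t; unfold p in *; lra).
apply cseries_tail in Pz. change (pow_n (K := C_Ring) t 0) with (RtoC 1) in Pz.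
replace (h z - h z0)%C with (h z - 1 * c O)%C by (rewrite H0; ring).
set (m := Cmod t / p).
assert (hm0 : 0 <= m) by (apply Rdiv_le_0_compat; [apply Cmod_ge_0|lra]).
assert (hm1 : m <= / 2). { unfold m. apply Rle_div_l; lra. }
apply Rle_lt_trans with (2 * (m * M)).
- rewrite <- (proj2 (Series_geom_half (m * M))).
  apply Cmod_cseries_le with (1 := Pz); [|apply Series_geom_half].
  intros j. rewrite Cmod_mult, Cmod_pow_n.
  replace (Cmod t ^ S j * Cmod (c (S j))) with (m ^ S j * Cmod (pow_n (K := C_Ring) (RtoC p) (S j) * c (S j))%C).
  + simpl. replace ((/ 2) ^ j * (m * M)) with (m * (/ 2) ^ j * M) by ring.
    apply Rmult_le_compat; [apply Rmult_le_pos; [lra|apply pow_le; lra]|apply Cmod_ge_0| |exact (HM (S j))].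
    apply Rmult_le_compat_l; [lra|]. apply pow_incr. lra.
  + rewrite Cmod_mult, Cmod_pow_n, Hp, <- Rmult_assoc, <- Rpow_mult_distr.
    do 2 f_equal. unfold m. field. lra.
- assert (E1 : m < eps / (2 * (M + 1))).
  { unfold m. apply Rlt_div_l; [lra|]. replace (eps / (2 * (M + 1)) * p) with (eps * p / (2 * (M + 1))) by (field; lra). exact ht2. }
  apply Rle_lt_trans with (2 * m * (M + 1)); [nra|].
  apply Rlt_le_trans with (2 * (eps / (2 * (M + 1))) * (M + 1)); [|right; field; lra].
  apply Rmult_lt_compat_r; lra.
Qed.

Lemma open_Cball (z0 : C) (r : R) : open (fun z : C => Cmod (z - z0) < r).
Proof.
intros z hz.
assert (hs : 0 < sqrt 2) by (apply sqrt_lt_R0; lra).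
assert (he : 0 < (r - Cmod (z - z0)) / sqrt 2) by (apply Rdiv_lt_0_compat; lra).
exists (mkposreal _ he). intros y hy.
generalize (C_NormedModule_mixin_compat2 z y _ hy). simpl.
replace (sqrt 2 * ((r - Cmod (z - z0)) / sqrt 2)) with (r - Cmod (z - z0)) by (field; lra).
change (minus y z) with (y - z)%C. intros H.
replace (y - z0)%C with ((y - z) + (z - z0))%C by ring.
apply Rle_lt_trans with (1 := Cmod_triangle _ _). lra.
Qed.

(** The discs attached to the points of [K] cover it; the largest threshold over a finite subcover
    serves all of [K]. *)
Lemma compact_eventually (K : C -> Prop) (Pr : nat -> C -> Prop) :
  compact_C K ->
  (forall z0, K z0 -> exists (r : R) (N : nat), 0 < r /\
     forall n z, (N <= n)%nat -> K z -> Cmod (z - z0) < r -> Pr n z) ->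
  exists N : nat, forall n, (N <= n)%nat -> forall z, K z -> Pr n z.
Proof.
intros HK H.
destruct (functional_choice (fun (i : {z0 | K z0}) (rN : R * nat) => 0 < fst rN /\
  forall n z, (snd rN <= n)%nat -> K z -> Cmod (z - proj1_sig i) < fst rN -> Pr n z)) as [F HF].
{ intros [z0 h0]. destruct (H z0 h0) as [r [N HrN]]. exists (r, N). exact HrN. }
destruct (HK {z0 | K z0} (fun i z => Cmod (z - proj1_sig i) < fst (F i))) as [l Hl].
- intros i. apply open_Cball.
- intros z hz. exists (exist _ z hz). simpl. replace (z - z)%C with (RtoC 0) by ring.
  rewrite Cmod_0. apply HF.
- exists (list_max (map (fun i => snd (F i)) l)). intros n hn z hz.
  destruct (Hl z hz) as [i [hi hzi]].
  apply (proj2 (HF i)); [|exact hz|exact hzi].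
  apply Nat.le_trans with (2 := hn).
  apply (proj1 (Forall_forall _ _) (proj1 (list_max_le _ _) (Nat.le_refl _))).
  apply in_map with (f := fun i => snd (F i)). exact hi.
Qed.

(** This is all that is asked of a growing solution at its starting index. Only points of [K] count:
    there alone g is known to be a second solution, and f may vanish elsewhere. *)
Definition locally_bounded_on (K : C -> Prop) (h : C -> C) : Prop :=
  forall z0, K z0 -> exists r B : R, 0 < r /\
    forall z, K z -> Cmod (z - z0) < r -> Cmod (h z) <= B.

Lemma locally_bounded_on_ext (K : C -> Prop) (g h : C -> C) :
  (forall z, K z -> g z = h z) -> locally_bounded_on K g -> locally_bounded_on K h.
Proof.
intros E H z0 hz0. destruct (H z0 hz0) as [r [B [hr HB]]]. exists r, B. split; [exact hr|].
intros z hz. rewrite <- E by exact hz. apply HB, hz.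
Qed.

Lemma locally_bounded_on_entire (K : C -> Prop) (h : C -> C) : entire h -> locally_bounded_on K h.
Proof.
intros H z0 _. destruct (analytic_at_continuous h z0 (H z0) 1 Rlt_0_1) as [r [hr Hr]].
exists r, (1 + Cmod (h z0)). split; [exact hr|]. intros z _ hz.
replace (h z) with ((h z - h z0) + h z0)%C by ring.
apply Rle_trans with (1 := Cmod_triangle _ _). generalize (Hr z hz). lra.
Qed.

Lemma locally_bounded_on_inv (K : C -> Prop) (h : C -> C) :
  entire h -> (forall z, K z -> h z <> RtoC 0) -> locally_bounded_on K (fun z => / h z)%C.
Proof.
intros H H0 z0 hz0.
assert (hp : 0 < Cmod (h z0)) by (apply Cmod_gt_0, H0, hz0).
destruct (analytic_at_continuous h z0 (H z0) (Cmod (h z0) / 2)) as [r [hr Hr]]; [lra|].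
exists r, (/ (Cmod (h z0) / 2)). split; [exact hr|]. intros z hz hzr.
rewrite Cmod_inv by (apply H0, hz). apply Rinv_le_contravar; [lra|].
generalize (Hr z hzr) (Cmod_triangle (h z) (- (h z - h z0))). rewrite Cmod_opp.
replace (h z + - (h z - h z0))%C with (h z0) by ring. lra.
Qed.

Lemma locally_bounded_on_op (K : C -> Prop) (op : C -> C -> C) (Bop : R -> R -> R) (g h : C -> C) :
  (forall x y A B, Cmod x <= A -> Cmod y <= B -> Cmod (op x y) <= Bop A B) ->
  locally_bounded_on K g -> locally_bounded_on K h -> locally_bounded_on K (fun z => op (g z) (h z)).
Proof.
intros Hop Hg Hh z0 hz0.
destruct (Hg z0 hz0) as [r1 [B1 [hr1 H1]]]. destruct (Hh z0 hz0) as [r2 [B2 [hr2 H2]]].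
exists (Rmin r1 r2), (Bop B1 B2). split; [apply Rmin_glb_lt; assumption|].
intros z hz hzr. apply Hop.
- apply H1; [exact hz|]. apply Rlt_le_trans with (1 := hzr), Rmin_l.
- apply H2; [exact hz|]. apply Rlt_le_trans with (1 := hzr), Rmin_r.
Qed.

Lemma locally_bounded_on_plus (K : C -> Prop) (g h : C -> C) :
  locally_bounded_on K g -> locally_bounded_on K h -> locally_bounded_on K (fun z => g z + h z)%C.
Proof.
apply locally_bounded_on_op with (Bop := Rplus). intros x y A B hx hy.
generalize (Cmod_triangle x y). lra.
Qed.

Lemma locally_bounded_on_mult (K : C -> Prop) (g h : C -> C) :
  locally_bounded_on K g -> locally_bounded_on K h -> locally_bounded_on K (fun z => g z * h z)%C.
Proof.
apply locally_bounded_on_op with (Bop := Rmult). intros x y A B hx hy.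
rewrite Cmod_mult. apply Rmult_le_compat; auto using Cmod_ge_0.
Qed.

Lemma locally_bounded_on_const (K : C -> Prop) (c : C) : locally_bounded_on K (fun _ => c).
Proof. intros z0 _. exists 1, (Cmod c). split; [lra|]. intros; lra. Qed.

Lemma locally_bounded_on_id (K : C -> Prop) : locally_bounded_on K (fun z => z).
Proof.
intros z0 _. exists 1, (1 + Cmod z0). split; [lra|]. intros z _ hz.
replace z with ((z - z0) + z0)%C at 1 by ring.
apply Rle_trans with (1 := Cmod_triangle _ _). lra.
Qed.

Lemma lim_recursion (rho : R) (y d : nat -> R) :
  0 <= rho -> rho < 1 -> is_lim_seq d 0 -> (forall n, y (S n) = rho * y n + d n) ->
  is_lim_seq y 0.
Proof.
intros h0 h1 Hd Hy. apply is_lim_seq_spec. intros eps.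
(* Under a forcing of this size the steady state is eps / 2; the other half of eps absorbs the
   geometrically fading memory of [y N]. *)
assert (he : 0 < eps * (1 - rho) / 2).
{ generalize (cond_pos eps). intros. apply Rdiv_lt_0_compat; [|lra]. apply Rmult_lt_0_compat; lra. }
destruct (proj2 (is_lim_seq_spec _ _) Hd (mkposreal _ he)) as [N HN].
assert (B : forall m, Rabs (y (N + m)%nat) <= rho ^ m * Rabs (y N) + eps / 2).
{ induction m as [|m IH].
  - rewrite Nat.add_0_r. simpl. generalize (cond_pos eps). lra.
  - replace (N + S m)%nat with (S (N + m)) by lia. rewrite Hy.
    apply Rle_trans with (1 := Rabs_triang _ _). rewrite Rabs_mult, (Rabs_pos_eq rho) by exact h0.
    generalize (HN (N + m)%nat ltac:(lia)). simpl. rewrite Rminus_0_r. intros Hm.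
    generalize (Rmult_le_compat_l rho _ _ h0 IH). lra. }
assert (G : is_lim_seq (fun m => Rabs (y N) * rho ^ m) 0).
{ apply lim_0_scal. apply is_lim_seq_geom. rewrite Rabs_pos_eq; lra. }
assert (he2 : 0 < eps / 2) by (generalize (cond_pos eps); lra).
destruct (proj2 (is_lim_seq_spec _ _) G (mkposreal _ he2)) as [M HM].
exists (N + M)%nat. intros n hn. rewrite Rminus_0_r.
replace n with (N + (n - N))%nat by lia.
apply Rle_lt_trans with (1 := B _).
generalize (HM (n - N)%nat ltac:(lia)). simpl. rewrite Rminus_0_r.
generalize (Rle_abs (Rabs (y N) * rho ^ (n - N))). lra.
Qed.

(** * Asymptotics of the coefficients *)

Lemma zeta_mult (x : R) : 1 < Rabs x -> zeta x * (x + root x) = 1.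
Proof.
intros hx. unfold zeta, root.
assert (hx2 : 0 <= x ^ 2 - 1).
{ rewrite <- (pow2_abs x). nra. }
assert (hs : sign x * sign x = 1).
{ destruct (Rlt_dec 0 x) as [h|h].
  - rewrite sign_eq_1 by exact h. ring.
  - rewrite sign_eq_m1; [ring|]. destruct (Req_dec x 0) as [->|]; [rewrite Rabs_R0 in hx; lra|lra]. }
replace ((x - sign x * sqrt (x ^ 2 - 1)) * (x + sign x * sqrt (x ^ 2 - 1)))
  with (x ^ 2 - (sign x * sign x) * (sqrt (x ^ 2 - 1) * sqrt (x ^ 2 - 1))) by ring.
rewrite hs, sqrt_sqrt by exact hx2. ring.
Qed.

Lemma zeta_neq_0 (x : R) : 1 < Rabs x -> zeta x <> 0.
Proof. intros hx E. generalize (zeta_mult x hx). rewrite E. lra. Qed.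

Lemma inv_zeta (x : R) : 1 < Rabs x -> / zeta x = x + root x.
Proof.
intros hx. generalize (zeta_mult x hx) (zeta_neq_0 x hx). intros E H.
apply Rmult_eq_reg_l with (zeta x); [|exact H]. rewrite E. field. exact H.
Qed.

Lemma root_opp (x : R) : root (- x) = - root x.
Proof.
unfold root. replace ((- x) ^ 2) with (x ^ 2) by ring.
rewrite sign_opp. ring.
Qed.

Lemma root_pos (x : R) : 0 < x -> root x = sqrt (x ^ 2 - 1).
Proof. intros hx. unfold root. rewrite sign_eq_1 by exact hx. ring. Qed.

Lemma zeta_abs (x : R) : 1 < Rabs x -> Rabs (zeta x) <= / Rabs x.
Proof.
intros hx. rewrite <- (Rinv_inv (zeta x)), Rabs_inv, inv_zeta by exact hx.
apply Rinv_le_contravar; [lra|].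
destruct (Rle_dec 0 x) as [h|h].
- rewrite (Rabs_pos_eq x) in * by exact h. rewrite root_pos by lra.
  generalize (sqrt_pos (x ^ 2 - 1)). intros. rewrite Rabs_pos_eq; lra.
- rewrite <- (Rabs_Ropp (x + root x)). replace (- (x + root x)) with (- x + root (- x)) by (rewrite root_opp; ring).
  rewrite Rabs_left in * by lra. rewrite root_pos by lra.
  generalize (sqrt_pos ((- x) ^ 2 - 1)). intros. rewrite Rabs_pos_eq; lra.
Qed.

Lemma root_lipschitz (c : R) : 1 < c ->
  exists L, 0 <= L /\ forall x y, c <= Rabs x -> c <= Rabs y -> 0 < x * y ->
    Rabs (root x - root y) <= L * Rabs (x - y).
Proof.
intros hc.
assert (hs : 0 < sqrt (c ^ 2 - 1)) by (apply sqrt_lt_R0; nra).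
(* The derivative x / sqrt(x^2 - 1) of the root decreases for x > 1, so its value at [c] is a
   Lipschitz constant; [key] expresses this monotonicity. *)
exists (c / sqrt (c ^ 2 - 1)).
assert (hL : 0 <= c / sqrt (c ^ 2 - 1)) by (left; apply Rdiv_lt_0_compat; lra).
split; [exact hL|].
assert (key : forall x, c <= x -> x <= c / sqrt (c ^ 2 - 1) * sqrt (x ^ 2 - 1)).
{ intros x hx. replace (c / sqrt (c ^ 2 - 1) * sqrt (x ^ 2 - 1)) with ((c * sqrt (x ^ 2 - 1)) / sqrt (c ^ 2 - 1)) by (field; lra).
  apply Rle_div_r; [exact hs|].
  apply Rsqr_incr_0; [|apply Rmult_le_pos; lra|apply Rmult_le_pos; [lra|apply sqrt_pos]].
  rewrite !Rsqr_mult, !Rsqr_sqrt by nra. unfold Rsqr. nra. }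
assert (pos : forall x y, c <= x -> c <= y -> Rabs (root x - root y) <= c / sqrt (c ^ 2 - 1) * Rabs (x - y)).
{ intros x y hx hy. rewrite !root_pos by lra.
  assert (sx : 0 < sqrt (x ^ 2 - 1)) by (apply sqrt_lt_R0; nra).
  assert (sy : 0 < sqrt (y ^ 2 - 1)) by (apply sqrt_lt_R0; nra).
  set (s := sqrt (x ^ 2 - 1) + sqrt (y ^ 2 - 1)).
  apply Rmult_le_reg_r with s; [unfold s; lra|].
  rewrite <- (Rabs_pos_eq s) at 1 by (unfold s; lra). rewrite <- Rabs_mult.
  replace ((sqrt (x ^ 2 - 1) - sqrt (y ^ 2 - 1)) * s) with ((x - y) * (x + y)).
  - rewrite Rabs_mult, (Rabs_pos_eq (x + y)) by lra.
    replace (c / sqrt (c ^ 2 - 1) * Rabs (x - y) * s) with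
      (Rabs (x - y) * (c / sqrt (c ^ 2 - 1) * sqrt (x ^ 2 - 1) + c / sqrt (c ^ 2 - 1) * sqrt (y ^ 2 - 1)))
      by (unfold s; ring).
    apply Rmult_le_compat_l; [apply Rabs_pos|]. generalize (key x hx) (key y hy). lra.
  - transitivity (sqrt (x ^ 2 - 1) * sqrt (x ^ 2 - 1) - sqrt (y ^ 2 - 1) * sqrt (y ^ 2 - 1)); [|unfold s; ring].
    rewrite !sqrt_sqrt by nra. ring. }
intros x y hx hy hxy.
destruct (Rle_dec 0 x) as [h|h].
- assert (0 < y) by nra. rewrite Rabs_pos_eq in hx, hy by lra. auto.
- assert (y < 0) by nra. rewrite Rabs_left in hx, hy by lra.
  generalize (pos (- x) (- y) hx hy). rewrite !root_opp.
  replace (- root x - - root y) with (- (root x - root y)) by ring.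
  replace (- x - - y) with (- (x - y)) by ring. rewrite !Rabs_Ropp. auto.
Qed.

Lemma ln_abs_le (x : R) : / 2 <= x -> Rabs (ln x) <= 2 * Rabs (x - 1).
Proof.
intros hx.
assert (H : forall y, 0 < y -> ln y <= y - 1).
{ intros y hy. rewrite <- (ln_exp (y - 1)). apply ln_le; [exact hy|].
  generalize (exp_ineq1_le (y - 1)). lra. }
generalize (H x ltac:(lra)) (H (/ x) ltac:(apply Rinv_0_lt_compat; lra)).
rewrite ln_Rinv by lra. intros H1 H2.
assert (H3 : / x - 1 <= 2 * Rabs (x - 1)).
{ replace (/ x - 1) with (/ x * (1 - x)) by (field; lra).
  assert (/ x <= 2). { rewrite <- (Rinv_inv 2). apply Rinv_le_contravar; lra. }
  assert (0 < / x) by (apply Rinv_0_lt_compat; lra).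
  generalize (Rle_abs (1 - x)) (Rabs_pos (x - 1)). rewrite Rabs_minus_sym. intros. nra. }
generalize (Rle_abs (x - 1)) (Rabs_pos (x - 1)). intros.
apply Rabs_le. lra.
Qed.

Lemma ex_series_eventually_le (u v : nat -> R) (N : nat) :
  (forall n, (N <= n)%nat -> Rabs (u n) <= v n) -> ex_series v -> ex_series u.
Proof.
intros H Hv. apply (ex_series_incr_n u N).
apply (ex_series_le (K := R_AbsRing) (V := R_CompleteNormedModule) _ (fun k => v (N + k)%nat)).
- intros n. apply H. lia.
- exact (proj1 (ex_series_incr_n v N) Hv).
Qed.

Section Coefficients.

Variables (a b : Z -> R) (beta_inf : R) (N0 : nat).
Hypotheses
  (a_pos : forall n : Z, (-1 <= n)%Z -> 0 < a n)
  (a_inv_summable : ex_series (fun n : nat => / a n))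
  (beta_lim : is_lim_seq (fun n : nat => beta a b n) beta_inf)
  (k_ell1 : ell1 (fun n : nat => kk a n - 1))
  (beta'_ell1 : ell1 (fun n : nat => beta a b (n + 1)%Z - beta a b n))
  (hN0 : admissible_N0 a b beta_inf N0).

Definition zet (n : nat) : R := zeta (beta a b n).

Lemma kappa_pos (n : nat) : 0 < kappa a n.
Proof.
unfold kappa. apply sqrt_lt_R0, Rdiv_lt_0_compat; apply a_pos; lia.
Qed.

Lemma kk_S (n : nat) : kk a (S n) = kappa a n / kappa a (S n).
Proof. unfold kk. do 2 f_equal. lia. Qed.

Lemma kk_pos (n : nat) : 0 < kk a (S n).
Proof. rewrite kk_S. apply Rdiv_lt_0_compat; apply kappa_pos. Qed.

Lemma kk_lim : is_lim_seq (fun n => kk a (S n)) 1.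
Proof.
generalize (ex_series_lim_0 _ k_ell1). intros H.
apply is_lim_seq_incr_1 in H.
apply (is_lim_seq_abs_0 (fun n => kk a (S n) - 1)) in H.
apply is_lim_seq_ext with (fun n => (kk a (S n) - 1) + 1); [intros; ring|].
replace (Finite 1) with (Finite (0 + 1)) by (f_equal; ring).
apply is_lim_seq_plus'; [exact H|apply is_lim_seq_const].
Qed.

(** The logarithms of [kk a (S n)] telescope to differences of ln kappa, and they are summable
    because |ln x| <= 2 |x - 1| near 1. Exponentiating the limit also shows that it is positive,
    which the uniqueness argument needs to bound 1/kappa_n. *)
Lemma kappa_lim_pos : exists l : R, 0 < l /\ is_lim_seq (fun n : nat => kappa a n) l.
Proof.
destruct (proj2 (is_lim_seq_spec _ _) kk_lim (mkposreal (/ 2) ltac:(lra))) as [N HN].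
change (forall n, (N <= n)%nat -> Rabs (kk a (S n) - 1) < / 2) in HN.
assert (Hs : ex_series (fun n => ln (kk a (S n)))).
{ apply ex_series_eventually_le with (N := N) (v := fun n => 2 * Rabs (kk a (S n) - 1)).
  - intros n hn. apply ln_abs_le. generalize (HN n hn).
    generalize (Rabs_maj2 (kk a (S n) - 1)). lra.
  - apply (ex_series_scal_l (K := R_AbsRing) 2 (fun n => Rabs (kk a (S n) - 1))).
    apply (ex_series_incr_1 (fun n : nat => Rabs (kk a n - 1))), k_ell1. }
destruct Hs as [S HS].
assert (E : forall n : nat, ln (kappa a (Datatypes.S n)) = ln (kappa a O) - sum_n (fun n => ln (kk a (Datatypes.S n))) n).
{ assert (E1 : forall n : nat, ln (kk a (Datatypes.S n)) = ln (kappa a n) - ln (kappa a (Datatypes.S n))).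
  { intros n. rewrite kk_S. apply ln_div; apply kappa_pos. }
  induction n as [|n IH].
  - rewrite sum_O, E1. ring.
  - rewrite sum_Sn, E1. unfold plus; simpl AbelianMonoid.sort.
    change (ln (kappa a (Datatypes.S (Datatypes.S n))) = ln (kappa a 0%nat) -
      (sum_n (fun n => ln (kk a (Datatypes.S n))) n + (ln (kappa a (Datatypes.S n)) - ln (kappa a (Datatypes.S (Datatypes.S n)))))).
    rewrite IH. ring. }
exists (exp (ln (kappa a O) - S)). split; [apply exp_pos|].
apply is_lim_seq_incr_1.
apply is_lim_seq_ext with (fun n => exp (ln (kappa a O) - sum_n (fun n => ln (kk a (Datatypes.S n))) n)).
{ intros n. rewrite <- E. apply exp_ln, kappa_pos. }
apply (is_lim_seq_continuous exp).
- apply derivable_continuous_pt, derivable_pt_exp.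
- apply is_lim_seq_minus'; [apply is_lim_seq_const|exact HS].
Qed.

Lemma kappa_inf_lim : is_lim_seq (fun n : nat => kappa a n) (kappa_inf a).
Proof.
destruct kappa_lim_pos as [l [_ hl]]. unfold kappa_inf.
rewrite (is_lim_seq_unique _ _ hl). exact hl.
Qed.

Lemma beta_separated : exists c, 1 < c /\ c <= Rabs beta_inf /\
  forall n, (N0 <= n)%nat -> c <= Rabs (beta a b n).
Proof.
destruct hN0 as [[c [hc H]] _]. exists c. split; [exact hc|]. split; [|exact H].
generalize (is_lim_seq_abs _ _ beta_lim). simpl. intros Hl.
apply (is_lim_seq_le_loc (fun _ => c) (fun n : nat => Rabs (beta a b n)) c (Rabs beta_inf));
  [exists N0; exact H|apply is_lim_seq_const|exact Hl].
Qed.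

Lemma beta_gt_1 (n : nat) : (N0 <= n)%nat -> 1 < Rabs (beta a b n).
Proof. destruct beta_separated as [c [hc [_ H]]]. intros hn. generalize (H n hn). lra. Qed.

Lemma zet_neq_0 (n : nat) : (N0 <= n)%nat -> zet n <> 0.
Proof. intros hn. apply zeta_neq_0, beta_gt_1, hn. Qed.

Lemma zet_beta (n : nat) : (N0 <= n)%nat -> 2 * beta a b n = zet n + / zet n.
Proof.
intros hn. unfold zet at 2. rewrite inv_zeta by (apply beta_gt_1, hn).
unfold zet, zeta. ring.
Qed.

Lemma zet_bound : exists q, 0 <= q /\ q < 1 /\ forall n, (N0 <= n)%nat -> Rabs (zet n) <= q.
Proof.
destruct beta_separated as [c [hc [_ H]]]. exists (/ c).
assert (0 < / c) by (apply Rinv_0_lt_compat; lra).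
split; [lra|]. split; [rewrite <- Rinv_1; apply Rinv_lt_contravar; lra|].
intros n hn. apply Rle_trans with (1 := zeta_abs _ (beta_gt_1 n hn)).
apply Rinv_le_contravar; [lra|apply H, hn].
Qed.

Lemma zet_lim : is_lim_seq zet (zeta beta_inf).
Proof.
destruct beta_separated as [c [hc [h0 H]]]. destruct (root_lipschitz c hc) as [L [hL HL]].
assert (Hr : is_lim_seq (fun n : nat => root (beta a b n) - root beta_inf) 0).
{ apply is_lim_seq_abs_0.
  apply (is_lim_seq_le_le_loc (fun _ => 0) _ (fun n : nat => L * Rabs (beta a b n - beta_inf))).
  - exists N0. intros n hn. split; [apply Rabs_pos|].
    apply HL; [apply H, hn|exact h0|apply (proj2 hN0), hn].
  - apply is_lim_seq_const.
  - replace (Finite 0) with (Rbar_mult L (Rabs (beta_inf - beta_inf))).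
    + apply is_lim_seq_scal_l. apply (is_lim_seq_abs _ (Finite (beta_inf - beta_inf))).
      apply is_lim_seq_minus'; [exact beta_lim|apply is_lim_seq_const].
    + simpl. f_equal. replace (beta_inf - beta_inf) with 0 by ring. rewrite Rabs_R0. ring. }
apply is_lim_seq_ext with (fun n : nat => (beta a b n - root beta_inf) - (root (beta a b n) - root beta_inf)).
{ intros n. unfold zet, zeta. ring. }
replace (zeta beta_inf) with ((beta_inf - root beta_inf) - 0) by (unfold zeta; ring).
apply is_lim_seq_minus'; [|exact Hr].
apply is_lim_seq_minus'; [exact beta_lim|apply is_lim_seq_const].
Qed.

(** 1/zeta(x) = x + root x is Lipschitz for |x| >= c > 1 on each side of 0, and all beta_n with n >=
    N0 lie on the side of beta_inf. *)
Lemma inv_zet_ell1 : ex_series (fun n => Rabs (/ zet (S n) - / zet n)).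
Proof.
destruct beta_separated as [c [hc [h0 H]]]. destruct (root_lipschitz c hc) as [L [hL HL]].
apply ex_series_eventually_le with (N := N0)
  (v := fun n : nat => (1 + L) * Rabs (beta a b (n + 1)%Z - beta a b n)).
- intros n hn. rewrite Rabs_Rabsolu.
  unfold zet. rewrite !inv_zeta by (apply beta_gt_1; lia).
  replace (n + 1)%Z with (Z.of_nat (S n)) by lia.
  replace (beta a b (S n) + root (beta a b (S n)) - (beta a b n + root (beta a b n)))
    with ((beta a b (S n) - beta a b n) + (root (beta a b (S n)) - root (beta a b n))) by ring.
  apply Rle_trans with (1 := Rabs_triang _ _).
  assert (hp : 0 < beta a b (S n) * beta a b n).
  { generalize (proj2 hN0 n hn) (proj2 hN0 (S n) ltac:(lia)). intros.
    assert (0 < (beta a b (S n) * beta a b n) * (beta_inf * beta_inf)) by nra.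
    nra. }
  generalize (HL _ _ (H (S n) ltac:(lia)) (H n hn) hp). lra.
- apply (ex_series_scal_l (K := R_AbsRing) (1 + L) (fun n : nat => Rabs (beta a b (n + 1)%Z - beta a b n))), beta'_ell1.
Qed.

Lemma Theta_S (n : nat) : (N0 <= n)%nat -> Theta a b N0 (S n) = Theta a b N0 n * zet n.
Proof.
intros hn. unfold Theta.
replace (S n - N0)%nat with (S (n - N0))%nat by lia.
rewrite seq_S, map_app. replace (N0 + (n - N0))%nat with n by lia. simpl map.
fold (zet n). generalize (map (fun m : nat => zeta (beta a b m)) (List.seq N0 (n - N0))).
intros l. induction l as [|x l IH]; simpl; [ring|]. rewrite IH. ring.
Qed.

Lemma Theta_N0 : Theta a b N0 N0 = 1.
Proof. unfold Theta. rewrite Nat.sub_diag. reflexivity. Qed.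

Lemma Theta_neq_0 (n : nat) : (N0 <= n)%nat -> Theta a b N0 n <> 0.
Proof.
intros hn. induction hn as [|n hn IH]; [rewrite Theta_N0; lra|].
rewrite Theta_S by exact hn. apply Rmult_integral_contrapositive_currified; [exact IH|apply zet_neq_0, hn].
Qed.

Lemma Theta_le_1 (n : nat) : (N0 <= n)%nat -> Rabs (Theta a b N0 n) <= 1.
Proof.
destruct zet_bound as [q [hq0 [hq1 Hq]]].
intros hn. induction hn as [|n hn IH]; [rewrite Theta_N0, Rabs_R1; lra|].
rewrite Theta_S by exact hn. rewrite Rabs_mult.
rewrite <- (Rmult_1_l 1). apply Rmult_le_compat; auto using Rabs_pos.
generalize (Hq n hn). lra.
Qed.

(** Arithmetic-geometric mean inequality for 1/a_n and 1/a_(n+1). *)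
Lemma inv_sqrt_a_summable : ex_series (fun n : nat => / (sqrt (a n) * sqrt (a (S n)))).
Proof.
apply ex_series_eventually_le with (N := O) (v := fun n : nat => / a n + / a (S n)).
- intros n _.
  assert (h1 : 0 < a n) by (apply a_pos; lia). assert (h2 : 0 < a (S n)) by (apply a_pos; lia).
  assert (s1 := sqrt_lt_R0 _ h1). assert (s2 := sqrt_lt_R0 _ h2).
  rewrite Rabs_pos_eq by (left; apply Rinv_0_lt_compat, Rmult_lt_0_compat; assumption).
  rewrite Rinv_mult. rewrite <- (sqrt_sqrt (a n)) at 2 by lra.
  rewrite <- (sqrt_sqrt (a (S n))) at 2 by lra. rewrite !Rinv_mult.
  generalize (Rle_0_sqr (/ sqrt (a n) - / sqrt (a (S n)))).
  assert (0 < / sqrt (a n) * / sqrt (a (S n))) by (apply Rmult_lt_0_compat; apply Rinv_0_lt_compat; assumption).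
  unfold Rsqr. lra.
- apply (ex_series_plus (K := R_AbsRing) (V := R_NormedModule) (fun n : nat => / a n) (fun n : nat => / a (S n)));
   [exact a_inv_summable|]. apply (ex_series_incr_1 (fun n : nat => / a n)), a_inv_summable.
Qed.

(** * Jost solutions *)

(** Since a_(n-1) is nonzero, the equation at n determines the value at n - 1. The induction ranges
    over all u, because each step overwrites one more value. *)
Lemma jacobi_backward_extension (z : C) (N : nat) (u : Z -> C) :
  (forall n : Z, (N <= n)%Z ->
     (a (n - 1)%Z * u (n - 1)%Z + b n * u n + a n * u (n + 1)%Z = z * u n)%C) ->
  exists v : Z -> C, jacobi_solution a b z v /\ forall n : Z, (N - 1 <= n)%Z -> v n = u n.
Proof.
revert u. induction N as [|N IH]; intros u H.
- exists u. split; [exact H|reflexivity].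
- set (w := fun n : Z => if Z.eq_dec n (N - 1) then
     (/ a (N - 1)%Z * ((z - b N) * u N - a N * u (N + 1)%Z))%C else u n).
  assert (Hw : forall n : Z, (N <= n)%Z -> w n = u n).
  { intros n hn. unfold w. destruct (Z.eq_dec n (N - 1)); [lia|reflexivity]. }
  destruct (IH w) as [v [Hv1 Hv2]].
  + intros n hn. rewrite (Hw n), (Hw (n + 1)%Z) by lia.
    destruct (Z.eq_dec n N) as [->|hne].
    * unfold w. destruct (Z.eq_dec (N - 1) (N - 1)); [|lia].
      assert (RtoC (a (N - 1)%Z) <> RtoC 0).
      { intros E. apply RtoC_inj in E. generalize (a_pos (N - 1)%Z ltac:(lia)). lra. }
      field. assumption.
    * rewrite Hw by lia. apply H. lia.
  + exists v. split; [exact Hv1|]. intros n hn. rewrite Hv2 by lia. apply Hw. lia.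
Qed.

Lemma RtoC_neq_0 (x : R) : x <> 0 -> RtoC x <> RtoC 0.
Proof. intros H E. apply H, RtoC_inj, E. Qed.

Lemma a_neq_0 (n : Z) : (-1 <= n)%Z -> RtoC (a n) <> RtoC 0.
Proof. intros hn. apply RtoC_neq_0. generalize (a_pos n hn). lra. Qed.

Lemma jacobi_previous (z : C) (u : Z -> C) (n : Z) : (0 <= n)%Z ->
  jacobi_solution a b z u ->
  u (n - 1)%Z = (/ a (n - 1)%Z * ((z - b n) * u n - a n * u (n + 1)%Z))%C.
Proof.
intros hn Hu. assert (Ha := a_neq_0 (n - 1) ltac:(lia)).
replace ((z - b n) * u n - a n * u (n + 1)%Z)%C with (a (n - 1)%Z * u (n - 1)%Z)%C.
- field. exact Ha.
- transitivity (z * u n - b n * u n - a n * u (n + 1)%Z)%C; [rewrite <- (Hu n hn); ring|ring].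
Qed.

Lemma jacobi_eventually_eq (z : C) (u v : Z -> C) (N : nat) :
  jacobi_solution a b z u -> jacobi_solution a b z v ->
  (forall n : nat, (N <= n)%nat -> u n = v n) -> forall n : Z, (-1 <= n)%Z -> u n = v n.
Proof.
intros Hu Hv H.
assert (Hk : forall k : nat, forall n : Z, (-1 <= n)%Z -> (N - k <= n)%Z -> u n = v n).
{ induction k as [|k IH]; intros n hn hk.
  - replace n with (Z.of_nat (Z.to_nat n)) by lia. apply H. lia.
  - destruct (Z_lt_le_dec n (N - k)) as [hlt|hge]; [|apply IH; lia].
    replace n with (n + 1 - 1)%Z by lia.
    rewrite (jacobi_previous z u), (jacobi_previous z v) by (assumption || lia).
    rewrite !(IH (n + 1)%Z), (IH (n + 1 + 1)%Z) by lia. reflexivity. }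
intros n hn. apply (Hk (S N)); lia.
Qed.

(** Inverse of the model a_n^(-1/2) Theta_n: [scale n * f n] is the unknown u_n of the
    substitution. *)
Definition scale (n : nat) : R := sqrt (a n) / Theta a b N0 n.

Lemma sqrt_a_pos (n : nat) : 0 < sqrt (a n).
Proof. apply sqrt_lt_R0, a_pos. lia. Qed.

Lemma scale_neq_0 (n : nat) : (N0 <= n)%nat -> scale n <> 0.
Proof.
intros hn. unfold scale. apply Rmult_integral_contrapositive_currified.
- generalize (sqrt_a_pos n). lra.
- apply Rinv_neq_0_compat, Theta_neq_0, hn.
Qed.

Lemma inv_scale (n : nat) : (N0 <= n)%nat -> / sqrt (a n) * Theta a b N0 n = / scale n.
Proof.
intros hn. unfold scale. generalize (sqrt_a_pos n) (Theta_neq_0 n hn). intros.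
field. split; lra.
Qed.

Lemma jost_asymptotics_iff (v : Z -> C) :
  jost_asymptotics a b N0 v <->
  filterlim (fun n : nat => scale n * v n)%C eventually (locally (RtoC 1)).
Proof.
split.
- intros [eps [He Hv]]. apply clim_iff. intros e he.
  destruct (proj1 (clim_iff _ _) He e he) as [N HN].
  exists (N + N0)%nat. intros n hn. rewrite Hv, inv_scale by lia.
  replace (scale n * (RtoC (/ scale n) * (1 + eps n)) - 1)%C with (eps n - 0)%C.
  + apply HN. lia.
  + rewrite RtoC_inv by (apply scale_neq_0; lia). field. apply RtoC_neq_0, scale_neq_0; lia.
- intros H. exists (fun n => scale n * v n - 1)%C. split.
  + rewrite clim_iff_Cmod. rewrite clim_iff_Cmod in H.
    apply is_lim_seq_ext with (2 := H). intros n. f_equal. ring.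
  + intros n hn. rewrite inv_scale by exact hn.
    rewrite RtoC_inv by (apply scale_neq_0; lia). field. apply RtoC_neq_0, scale_neq_0; lia.
Qed.

Lemma kappa_sqrt (n : nat) : kappa a n = sqrt (a (S n)) / sqrt (a n).
Proof.
unfold kappa. rewrite sqrt_div_alt by (apply a_pos; lia).
do 3 f_equal. lia.
Qed.

(** The prefactor arises from a_n / (sqrt a_n sqrt a_(n+1)) = 1/kappa_n. Being bounded, it lets the
    limit of the scaled determinant decide the Wronskian; being nonzero, it lets a zero Wronskian
    annihilate that determinant. *)
Lemma wronskian_scaled (z : C) (u v : Z -> C) (n : nat) : (N0 <= n)%nat ->
  jacobi_solution a b z u -> jacobi_solution a b z v ->
  wronskian a u v = (RtoC (/ kappa a n * (Theta a b N0 n * Theta a b N0 (S n))) *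
    ((scale n * u n) * (scale (S n) * v (S n)) - (scale (S n) * u (S n)) * (scale n * v n)))%C.
Proof.
intros hn Hu Hv. rewrite <- (wronskian_at_const a b z u v Hu Hv n) by lia.
unfold wronskian_at. replace (n + 1)%Z with (Z.of_nat (S n)) by lia.
rewrite kappa_sqrt. unfold scale.
assert (h0 := sqrt_a_pos n). assert (h1 := sqrt_a_pos (S n)).
assert (t0 := Theta_neq_0 n hn). assert (t1 := Theta_neq_0 (S n) ltac:(lia)).
assert (ea : a n = sqrt (a n) * sqrt (a n)) by (symmetry; apply sqrt_sqrt; left; apply a_pos; lia).
rewrite ea at 1.
set (x := sqrt (a n)) in *. set (y := sqrt (a (S n))) in *.
set (p := Theta a b N0 n) in *. set (q := Theta a b N0 (S n)) in *.
transitivity (RtoC (/ (y / x) * (p * q) * (x / p) * (y / q)) * (u n * v (S n) - u (S n) * v n))%C.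
- f_equal. f_equal. field. repeat split; lra.
- rewrite !RtoC_mult. ring.
Qed.

(* The Wronskian of two Jost solutions is constant and tends to 0, so they are proportional. *)
Lemma jost_unique (z : C) (u v : Z -> C) :
  jacobi_solution a b z u -> jacobi_solution a b z v ->
  jost_asymptotics a b N0 u -> jost_asymptotics a b N0 v ->
  forall n : Z, (-1 <= n)%Z -> u n = v n.
Proof.
intros Hu Hv Au Av. apply jost_asymptotics_iff in Au, Av.
set (U := fun n : nat => (scale n * u n)%C) in *.
set (V := fun n : nat => (scale n * v n)%C) in *.
assert (W0 : wronskian a u v = 0).
{ apply Cmod_eq_0.
  destruct (kappa_lim_pos) as [l [hl Hl]].
  assert (HD : is_lim_seq (fun n => Cmod (U n * V (S n) - U (S n) * V n)) 0).
  { assert (UV := clim_mult _ _ _ _ Au (clim_incr_1 _ _ Av)).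
    assert (VU := clim_mult _ _ _ _ (clim_incr_1 _ _ Au) Av).
    apply clim_iff_Cmod in UV, VU.
    refine (lim_0_le _ _ O _ (lim_0_plus _ _ UV VU)).
    intros n _. split; [apply Cmod_ge_0|].
    rewrite <- (Cmod_opp (U (S n) * V n - 1 * 1)).
    eapply Rle_trans; [|apply Cmod_triangle]. right. f_equal. ring. }
  assert (Hlim : is_lim_seq (fun _ : nat => Cmod (wronskian a u v)) 0).
  { refine (lim_0_le _ _ N0 _ (lim_0_mult _ _ _ (is_lim_seq_inv _ _ Hl _) HD)).
    - intros n hn. split; [apply Cmod_ge_0|].
      rewrite (wronskian_scaled z u v n hn Hu Hv). fold (U n) (U (S n)) (V n) (V (S n)).
      rewrite Cmod_mult, Cmod_R. apply Rmult_le_compat_r; [apply Cmod_ge_0|].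
      rewrite Rabs_mult, Rabs_inv, (Rabs_pos_eq (kappa a n)) by (left; apply kappa_pos).
      rewrite <- (Rmult_1_r (/ kappa a n)) at 2.
      apply Rmult_le_compat_l; [left; apply Rinv_0_lt_compat, kappa_pos|].
      rewrite Rabs_mult, <- (Rmult_1_l 1).
      apply Rmult_le_compat; try apply Rabs_pos; apply Theta_le_1; lia.
    - intros E. apply Rbar_finite_eq in E. lra. }
  apply is_lim_seq_unique in Hlim. rewrite Lim_seq_const in Hlim.
  apply Rbar_finite_eq in Hlim. exact Hlim. }
destruct (proj1 (clim_iff _ _) Au 1 Rlt_0_1) as [N HN].
assert (U0 : forall n, (N <= n)%nat -> U n <> 0).
{ intros n hn E. generalize (HN n hn). rewrite E.
  replace (0 - 1)%C with (- (1))%C by ring. rewrite Cmod_m1. lra. }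
set (M := (N + N0)%nat).
(* A zero Wronskian means that V/U takes equal values at consecutive indices, once U no longer
   vanishes; the limits then force the common ratio to be 1. *)
assert (Hc : forall n, (M <= n)%nat -> V n = (V M / U M * U n)%C).
{ intros n hn. induction hn as [|n hn IH]; [field; apply U0; unfold M; lia|].
  assert (E := wronskian_scaled z u v n ltac:(lia) Hu Hv). rewrite W0 in E.
  fold (U n) (U (S n)) (V n) (V (S n)) in E.
  assert (E1 : (U n * V (S n) - U (S n) * V n = 0)%C).
  { apply Cmult_eq_reg_l with (1 := eq_trans (eq_sym E) (eq_sym (Cmult_0_r _))).
    apply RtoC_neq_0. apply Rmult_integral_contrapositive_currified.
    - apply Rinv_neq_0_compat. generalize (kappa_pos n). lra.
    - apply Rmult_integral_contrapositive_currified; apply Theta_neq_0; lia. }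
  assert (hU : U n <> 0) by (apply U0; unfold M in hn; lia).
  apply Cmult_eq_reg_l with (U n); [|exact hU].
  replace (U n * V (S n))%C with (U n * V (S n) - U (S n) * V n + U (S n) * V n)%C by ring.
  rewrite E1, IH. ring. }
assert (Ec : (V M / U M)%C = 1).
{ assert (L := clim_ext _ _ _ M Hc Av).
  assert (L' := clim_scal (V M / U M) _ _ Au). rewrite Cmult_1_r in L'.
  exact (clim_unique _ _ _ L' L). }
apply (jacobi_eventually_eq z u v M Hu Hv). intros n hn.
assert (E := Hc n hn). rewrite Ec, Cmult_1_l in E. unfold U, V in E.
apply Cmult_eq_reg_l with (RtoC (scale n)); [symmetry; exact E|].
apply RtoC_neq_0, scale_neq_0. unfold M in hn. lia.
Qed.

Lemma b_eq (n : nat) : (N0 <= n)%nat ->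
  b (S n) = - (zet (S n) + / zet (S n)) * (sqrt (a n) * sqrt (a (S n))).
Proof.
intros hn. rewrite <- zet_beta by lia. unfold beta.
replace (S n - 1)%Z with (Z.of_nat n) by lia.
rewrite sqrt_mult_alt by (left; apply a_pos; lia).
generalize (sqrt_a_pos n) (sqrt_a_pos (S n)). intros. field. split; lra.
Qed.

(* For f_n = u_n / scale n the Jacobi equation at n + 1 becomes
   (u_n - u_(n+1)) - jost_ratio n (u_(n+1) - u_(n+2))
     = (jost_potential n + z jost_spectral n) u_(n+1),
   because 2 beta_n = zeta_n + 1 / zeta_n. *)
Definition jost_ratio (n : nat) : R := zet n * kk a (S n) * zet (S n).

Definition jost_potential (n : nat) : R :=
  zet n * ((1 - kk a (S n)) * zet (S n) + (/ zet (S n) - / zet n)).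

Definition jost_spectral (n : nat) : R := zet n * / (sqrt (a n) * sqrt (a (S n))).

(** Here x, y, w are the square roots of a_n, a_(n+1), a_(n+2), t is Theta_n, and p, s are zeta_n,
    zeta_(n+1). The defect of the Jacobi equation is the defect of the difference equation times the
    nonzero factor x t. *)
Lemma jacobi_jost_identity (x y w t p s : R) (z u0 u1 u2 : C) :
  x <> 0 -> y <> 0 -> w <> 0 -> t <> 0 -> p <> 0 -> s <> 0 ->
  (RtoC (x * x) * (RtoC (/ (x / t)) * u0)
     + RtoC (- (s + / s) * (x * y)) * (RtoC (/ (y / (t * p))) * u1)
     + RtoC (y * y) * (RtoC (/ (w / (t * p * s))) * u2) - z * (RtoC (/ (y / (t * p))) * u1)
   = RtoC (x * t) * (u0 - u1 - RtoC (p * (y / x / (w / y)) * s) * (u1 - u2)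
       - (RtoC (p * ((1 - (y / x / (w / y))) * s + (/ s - / p))) + z * RtoC (p * / (x * y))) * u1))%C.
Proof.
intros. destruct u0, u1, u2, z.
apply injective_projections; simpl; field; repeat split; assumption.
Qed.

Lemma jacobi_jost_substitution (z : C) (n : nat) (u0 u1 u2 : C) : (N0 <= n)%nat ->
  (u0 - u1 - jost_ratio n * (u1 - u2) = (jost_potential n + z * jost_spectral n) * u1)%C ->
  (a n * (RtoC (/ scale n) * u0) + b (S n) * (RtoC (/ scale (S n)) * u1)
     + a (S n) * (RtoC (/ scale (S (S n))) * u2) = z * (RtoC (/ scale (S n)) * u1))%C.
Proof.
intros hn H.
assert (h0 := sqrt_a_pos n). assert (h1 := sqrt_a_pos (S n)). assert (h2 := sqrt_a_pos (S (S n))).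
assert (t0 := Theta_neq_0 n hn). assert (p0 := zet_neq_0 n hn). assert (p1 := zet_neq_0 (S n) ltac:(lia)).
assert (ea : forall m : nat, a m = sqrt (a m) * sqrt (a m))
  by (intros m; symmetry; apply sqrt_sqrt; left; apply a_pos; lia).
apply Ceq_minus. unfold jost_ratio, jost_potential, jost_spectral in H.
rewrite kk_S, !kappa_sqrt in H.
rewrite (ea n), (ea (S n)), (b_eq n hn). unfold scale.
rewrite (Theta_S (S n)), (Theta_S n) by lia.
rewrite jacobi_jost_identity by (assumption || lra).
rewrite H. ring.
Qed.

Lemma jost_potential_summable : summable (fun n => RtoC (jost_potential n)).
Proof.
destruct zet_bound as [q [hq0 [hq1 Hq]]].
apply ex_series_eventually_le with (N := N0)
  (v := fun n => Rabs (kk a (S n) - 1) + Rabs (/ zet (S n) - / zet n)).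
- intros n hn. rewrite Cmod_R, Rabs_Rabsolu. unfold jost_potential.
  rewrite Rabs_mult, <- (Rmult_1_l (Rabs (kk a (S n) - 1) + _)).
  apply Rmult_le_compat; try apply Rabs_pos; [generalize (Hq n hn); lra|].
  eapply Rle_trans; [apply Rabs_triang|]. apply Rplus_le_compat_r.
  rewrite Rabs_mult, (Rabs_minus_sym 1). rewrite <- (Rmult_1_r (Rabs (kk a (S n) - 1))) at 2.
  apply Rmult_le_compat_l; [apply Rabs_pos|]. generalize (Hq (S n) ltac:(lia)). lra.
- apply (ex_series_plus (K := R_AbsRing) (V := R_NormedModule)); [|apply inv_zet_ell1].
  apply (ex_series_incr_1 (fun n : nat => Rabs (kk a n - 1))), k_ell1.
Qed.

Lemma jost_spectral_summable : summable (fun n => RtoC (jost_spectral n)).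
Proof.
destruct zet_bound as [q [hq0 [hq1 Hq]]].
apply ex_series_eventually_le with (N := N0)
  (v := fun n : nat => / (sqrt (a n) * sqrt (a (S n)))); [|apply inv_sqrt_a_summable].
intros n hn. rewrite Cmod_R, Rabs_Rabsolu. unfold jost_spectral.
assert (0 < / (sqrt (a n) * sqrt (a (S n))))
  by (apply Rinv_0_lt_compat, Rmult_lt_0_compat; apply sqrt_a_pos).
rewrite Rabs_mult, (Rabs_pos_eq (/ _)) by lra.
rewrite <- (Rmult_1_l (/ _)) at 2. apply Rmult_le_compat_r; [lra|]. generalize (Hq n hn). lra.
Qed.

Lemma jost_ratio_bound : exists q N, 0 <= q /\ q < 1 /\
  forall n, (N <= n)%nat -> Rabs (jost_ratio n) <= q.
Proof.
destruct zet_bound as [q [hq0 [hq1 Hq]]].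
exists q.
(* Once k <= 1/q, the ratio is at most q (1/q) q = q. For q = 0 this threshold makes no sense, but
   the ratio vanishes. *)
destruct (Req_dec q 0) as [->|hq].
{ exists N0. split; [lra|]. split; [lra|]. intros n hn. unfold jost_ratio.
  rewrite Rabs_mult. generalize (Hq (S n) ltac:(lia)) (Rabs_pos (zet (S n))). intros.
  replace (Rabs (zet (S n))) with 0 by lra. lra. }
assert (he : 0 < / q - 1).
{ assert (1 < / q); [rewrite <- Rinv_1; apply Rinv_lt_contravar; lra|lra]. }
destruct (proj2 (is_lim_seq_spec _ _) kk_lim (mkposreal _ he)) as [N HN].
change (forall n, (N <= n)%nat -> Rabs (kk a (S n) - 1) < / q - 1) in HN.
exists (N + N0)%nat. split; [lra|]. split; [exact hq1|].
intros n hn. unfold jost_ratio. rewrite !Rabs_mult.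
assert (Hk : Rabs (kk a (S n)) <= / q).
{ generalize (HN n ltac:(lia)) (kk_pos n) (Rle_abs (kk a (S n) - 1)). intros.
  rewrite Rabs_pos_eq; lra. }
assert (H1 := Hq n ltac:(lia)). assert (H2 := Hq (S n) ltac:(lia)).
apply Rle_trans with (q * / q * q); [|right; field; exact hq].
repeat apply Rmult_le_compat; try apply Rabs_pos; try assumption.
apply Rmult_le_pos; apply Rabs_pos.
Qed.

Lemma jost_local (z0 : C) :
  exists (N : nat) (c : nat -> nat -> C) (U : nat -> C -> C) (tau : nat -> R),
    (N0 <= N)%nat /\ is_lim_seq tau 0 /\
    forall z : C, Cmod (z - z0) < 1 ->
      exists v : Z -> C, jacobi_solution a b z v /\
        forall i : nat, v (N + i)%nat = (RtoC (/ scale (N + i)) * U i (z - z0)%C)%C /\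
          is_pseries (K := C_AbsRing) (V := C_NormedModule) (c i) (z - z0)%C (U i (z - z0)%C) /\
          Cmod (U i (z - z0)%C - 1) <= tau i.
Proof.
destruct jost_ratio_bound as [q [N1 [hq0 [hq1 Hq]]]].
assert (Kpos : 0 < / (1 - q)) by (apply Rinv_0_lt_compat; lra).
(* Recentring at z0: z0 s_n joins the potential, and the remaining parameter t = z - z0 ranges over
   the unit disc. *)
set (r := fun n => (jost_potential n + z0 * jost_spectral n)%C).
set (s := fun n => RtoC (jost_spectral n)).
assert (Hs : summable s) by apply jost_spectral_summable.
assert (Hr : summable r) by (apply summable_plus_scal; [apply jost_potential_summable|exact Hs]).
assert (Hev : exists N2, forall n, (N2 <= n)%nat ->
   / (1 - q) * tail_sum r n <= / 2 /\ / (1 - q) * tail_sum s n <= / 4).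
{ assert (L : forall h, summable h -> exists N2, forall n, (N2 <= n)%nat -> / (1 - q) * tail_sum h n <= / 4).
  { intros h Hh. generalize (lim_0_scal (/ (1 - q)) _ (tail_lim h Hh)). intros L.
    destruct (proj2 (is_lim_seq_spec _ _) L (mkposreal (/ 4) ltac:(lra))) as [N2 HN].
    exists N2. intros n hn. generalize (HN n hn). simpl. rewrite Rminus_0_r.
    generalize (Rle_abs (/ (1 - q) * tail_sum h n)). lra. }
  destruct (L r Hr) as [Nr HNr]. destruct (L s Hs) as [Ns HNs]. exists (Nr + Ns)%nat.
  intros n hn. split; [generalize (HNr n ltac:(lia)); lra|apply HNs; lia]. }
destruct Hev as [N2 HN2].
set (N := (N0 + N1 + N2)%nat).
destruct (perturbed_solution (fun i => jost_ratio (N + i)) q hq0 hq1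
   (fun n => Hq (N + n)%nat ltac:(unfold N; lia)) (fun i => r (N + i)%nat) (fun i => s (N + i)%nat)
   (summable_shift r N Hr) (summable_shift s N Hs)
   (proj1 (HN2 N ltac:(unfold N; lia))) (proj2 (HN2 N ltac:(unfold N; lia))))
  as [c [U [tau [Htau HU]]]].
exists N, (fun i j => c j i), U, tau. split; [unfold N; lia|]. split; [exact Htau|].
intros z hz.
(* Values at k < N are meaningless here. The equation is verified from [S N] on, and the extension
   keeps only the values from N on. *)
set (w := fun k : Z => (RtoC (/ scale (Z.to_nat k)) * U (Z.to_nat k - N)%nat (z - z0)%C)%C).
destruct (jacobi_backward_extension z (S N) w) as [v [Hv1 Hv2]].
{ intros k hk.
  replace k with (Z.of_nat (S (N + (Z.to_nat k - S N)))) by lia.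
  generalize (Z.to_nat k - S N)%nat. clear k hk. intros i.
  replace (S (N + i) - 1)%Z with (Z.of_nat (N + i)) by lia.
  replace (S (N + i) + 1)%Z with (Z.of_nat (S (S (N + i)))) by lia.
  unfold w. rewrite !Nat2Z.id.
  replace (N + i - N)%nat with i by lia. replace (S (N + i) - N)%nat with (S i) by lia.
  replace (S (S (N + i)) - N)%nat with (S (S i)) by lia.
  apply jacobi_jost_substitution; [unfold N; lia|].
  generalize (proj1 (proj2 (HU _ hz i))). unfold second_diff. intros E.
  etransitivity; [exact E|]. unfold r, s. ring. }
exists v. split; [exact Hv1|]. intros i. split; [|split].
- rewrite Hv2 by lia. unfold w. rewrite Nat2Z.id. do 2 f_equal. lia.
- apply (HU _ hz i).
- apply (HU _ hz i).
Qed.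

(** The rate [tau] is common to a whole disc, which the asymptotics at single points would not give;
    the radius 1 is that of the local power series. *)
Definition locally_uniform_jost (f : Z -> C -> C) : Prop :=
  forall z0 : C, exists (N : nat) (tau : nat -> R), (N0 <= N)%nat /\ is_lim_seq tau 0 /\
    forall z, Cmod (z - z0) < 1 -> forall n : nat, (N <= n)%nat ->
      Cmod (scale n * f n z - 1) <= tau n.

(** The solutions are chosen for each z separately, with no link between different z. Uniqueness
    identifies them on every unit disc with the local analytic family, which gives analyticity for
    large n; the backward recursion carries it down to n = -1. *)
Lemma jost_family :
  exists f : Z -> C -> C,
    (forall z, jacobi_solution a b z (fun n => f n z)) /\
    (forall z, jost_asymptotics a b N0 (fun n => f n z)) /\
    (forall n : Z, (-1 <= n)%Z -> entire (f n)) /\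
    locally_uniform_jost f.
Proof.
assert (loc : forall z0, exists (N : nat) (c : nat -> nat -> C) (tau : nat -> R),
  (N0 <= N)%nat /\ is_lim_seq tau 0 /\ forall z, Cmod (z - z0) < 1 ->
    exists v : Z -> C, jacobi_solution a b z v /\ jost_asymptotics a b N0 v /\
      forall n : nat, (N <= n)%nat -> Cmod (scale n * v n - 1) <= tau n /\
        cseries (fun j => pow_n (K := C_Ring) (z - z0)%C j * c n j)%C (v n)).
{ intros z0. destruct (jost_local z0) as [N [c [U [tau [hN [Htau H]]]]]].
  assert (sc : forall n, (N <= n)%nat -> RtoC (scale n) <> RtoC 0)
    by (intros n hn; apply RtoC_neq_0, scale_neq_0; lia).
  assert (Htau' : is_lim_seq (fun n => tau (n - N)%nat) 0).
  { apply (is_lim_seq_incr_n _ N). apply is_lim_seq_ext with (2 := Htau). intros n. f_equal. lia. }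
  exists N, (fun n j => / scale n * c (n - N)%nat j)%C, (fun n => tau (n - N)%nat).
  split; [exact hN|]. split; [exact Htau'|].
  intros z hz. destruct (H z hz) as [v [Hv Hi]]. exists v. split; [exact Hv|].
  assert (B : forall n : nat, (N <= n)%nat -> Cmod (scale n * v n - 1) <= tau (n - N)%nat).
  { intros n hn. destruct (Hi (n - N)%nat) as [E [_ B]].
    replace (N + (n - N))%nat with n in E by lia. rewrite E.
    rewrite RtoC_inv by (apply scale_neq_0; lia).
    replace (scale n * (/ scale n * U (n - N)%nat (z - z0)%C) - 1)%C with (U (n - N)%nat (z - z0)%C - 1)%C
      by (field; apply sc, hn). exact B. }
  split.
  - apply jost_asymptotics_iff, clim_iff_Cmod.
    refine (lim_0_le _ _ N _ Htau'). intros n hn. split; [apply Cmod_ge_0|apply B, hn].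
  - intros n hn. split; [apply B, hn|].
    destruct (Hi (n - N)%nat) as [E [P _]].
    replace (N + (n - N))%nat with n in E by lia.
    change (cseries (fun j => pow_n (K := C_Ring) (z - z0)%C j * c (n - N)%nat j)%C (U (n - N)%nat (z - z0)%C)) in P.
    refine (cseries_ext _ _ _ _ _ _ (cseries_scal (/ scale n)%C _ _ P)).
    + intros j. ring.
    + rewrite E, RtoC_inv by (apply scale_neq_0; lia). reflexivity. }
destruct (functional_choice (fun z v => jacobi_solution a b z v /\ jost_asymptotics a b N0 v)) as [F HF].
{ intros z. destruct (loc z) as [N [c [tau [_ [_ H]]]]].
  destruct (H z) as [v [Hv [Jv _]]]; [|exists v; auto].
  replace (z - z)%C with (RtoC 0) by ring. rewrite Cmod_0. lra. }
assert (loc' : forall z0, exists (N : nat) (c : nat -> nat -> C) (tau : nat -> R),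
  (N0 <= N)%nat /\ is_lim_seq tau 0 /\ forall z, Cmod (z - z0) < 1 ->
      forall n : nat, (N <= n)%nat -> Cmod (scale n * F z n - 1) <= tau n /\
        cseries (fun j => pow_n (K := C_Ring) (z - z0)%C j * c n j)%C (F z n)).
{ intros z0. destruct (loc z0) as [N [c [tau [hN [Htau H]]]]]. exists N, c, tau.
  split; [exact hN|]. split; [exact Htau|]. intros z hz n hn.
  destruct (H z hz) as [v [Hv [Jv Hn]]].
  rewrite (jost_unique z (F z) v (proj1 (HF z)) Hv (proj2 (HF z)) Jv n) by lia. apply Hn, hn. }
exists (fun n z => F z n). split; [apply HF|]. split; [apply HF|]. split.
- intros n hn z0. destruct (loc' z0) as [N [c [tau [hN [_ H]]]]].
  assert (A : forall m : nat, (N <= m)%nat -> analytic_at (fun z => F z m) z0).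
  { intros m hm. exists 1, (c m). split; [lra|]. intros z hz. apply (H z hz m hm). }
  assert (Hk : forall k : nat, forall n : Z, (-1 <= n)%Z -> (N - k <= n)%Z -> analytic_at (fun z => F z n) z0).
  { induction k as [|k IH]; intros m hm hk.
    - replace m with (Z.of_nat (Z.to_nat m)) by lia. apply A. lia.
    - destruct (Z_lt_le_dec m (N - k)) as [hlt|hge]; [|apply IH; lia].
      replace m with (m + 1 - 1)%Z by lia.
      refine (analytic_at_three_term (fun z => F z (m + 1)%Z) (fun z => F z (m + 1 + 1)%Z) _ z0
        (/ a (m + 1 - 1)%Z) (b (m + 1)%Z) (a (m + 1)%Z) _ _ _); [apply IH; lia..|].
      intros z. apply jacobi_previous; [lia|apply HF]. }
  apply (Hk (S N) n hn). lia.
- intros z0. destruct (loc' z0) as [N [c [tau [hN [Htau H]]]]]. exists N, tau.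
  split; [exact hN|]. split; [exact Htau|]. intros z hz n hn. apply (H z hz n hn).
Qed.

(** * Growing solutions *)

(** From 1/zeta - zeta = 2 root one gets 1 - zeta^2 = 2 zeta root. The equation says that kappa_inf
    / (2 root) is the fixed point of X -> zeta^2 X + zeta kappa_inf. *)
Lemma growing_fixed_point : 1 < Rabs beta_inf ->
  zeta beta_inf * kappa_inf a = (1 - zeta beta_inf ^ 2) * (kappa_inf a / (2 * root beta_inf)).
Proof.
intros h1. assert (H := zeta_mult beta_inf h1). assert (H0 := zeta_neq_0 beta_inf h1).
assert (hr : root beta_inf <> 0).
{ unfold root. apply Rmult_integral_contrapositive_currified.
  - intros E. destruct (Rtotal_order beta_inf 0) as [h|[h|h]].
    + rewrite sign_eq_m1 in E; lra.
    + rewrite h, Rabs_R0 in h1. lra.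
    + rewrite sign_eq_1 in E; lra.
  - apply Rgt_not_eq, sqrt_lt_R0. rewrite <- pow2_abs. nra. }
assert (E : 1 - zeta beta_inf ^ 2 = zeta beta_inf * (2 * root beta_inf)).
{ rewrite <- H. unfold zeta. ring. }
rewrite E. field. exact hr.
Qed.

(** The constant 8 is 2 / (1/4): |u v - 1| <= 2 (s + t) and |u v| >= 1/4. *)
Lemma inv_mult_near_1 (u v : C) (s t : R) :
  Cmod (u - 1) <= s -> Cmod (v - 1) <= t -> s <= / 2 -> t <= / 2 ->
  Cmod (/ (u * v) - 1) <= 8 * (s + t).
Proof.
intros hu hv hs ht.
assert (lb : forall w e, Cmod (w - 1) <= e -> e <= / 2 -> / 2 <= Cmod w).
{ intros w e hw he. generalize (Cmod_triangle w (- (w - 1))). rewrite Cmod_opp.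
  replace (w + - (w - 1))%C with (RtoC 1) by ring. rewrite Cmod_1. lra. }
assert (lu := lb u s hu hs). assert (lv := lb v t hv ht).
assert (hn : (u * v)%C <> 0).
{ apply Cmult_neq_0; apply Cmod_gt_0; lra. }
replace (/ (u * v) - 1)%C with (- ((u * v - 1 * 1) / (u * v)))%C by (field; split; intros E; apply hn; rewrite E; ring).
rewrite Cmod_opp, Cmod_div, Cmod_mult by exact hn.
assert (H := Cmod_mult_sub_le u v 1 1). rewrite Cmod_1 in H.
assert (hp : 0 < Cmod u * Cmod v) by (apply Rmult_lt_0_compat; lra).
apply Rle_div_l; [exact hp|].
assert (/ 4 <= Cmod u * Cmod v) by nra.
generalize (Cmod_ge_0 (u - 1)) (Cmod_ge_0 (v - 1)). intros.
assert (Cmod (u - 1) * Cmod (v - 1) <= / 2 * t) by (apply Rmult_le_compat; lra).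
assert (8 * (s + t) * / 4 <= 8 * (s + t) * (Cmod u * Cmod v)) by (apply Rmult_le_compat_l; lra).
lra.
Qed.

(* Used with u = scale f and X = Theta^2 v / f, so that X u = sqrt a Theta v;
   as zeta_n^2 -> zeta^2 < 1, X is attracted by the fixed point of the limit recursion. *)
Lemma growing_recursion_limit (D : C -> Prop) (N : nat) (u X : nat -> C -> C) (tau : nat -> R)
    (c : C -> C) (Bc BX : R) :
  1 < Rabs beta_inf -> (N0 <= N)%nat -> is_lim_seq tau 0 ->
  (forall n, (N <= n)%nat -> tau n <= / 2) ->
  (forall n z, (N <= n)%nat -> D z -> Cmod (u n z - 1) <= tau n) ->
  0 <= Bc -> (forall z, D z -> Cmod (c z) <= Bc) -> (forall z, D z -> Cmod (X N z) <= BX) ->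
  (forall n z, (N <= n)%nat -> D z ->
     X (S n) z = (RtoC (zet n ^ 2) * X n z + c z * (RtoC (zet n * kappa a n) * / (u n z * u (S n) z)))%C) ->
  exists d : nat -> R, is_lim_seq d 0 /\ forall n z, (N <= n)%nat -> D z ->
    Cmod (X n z * u n z - c z * RtoC (kappa_inf a / (2 * root beta_inf))) <= d n.
Proof.
intros h1 hN Htau tau2 Hu hBc Hc HX HS.
set (l := kappa_inf a / (2 * root beta_inf)).
destruct zet_bound as [q [hq0 [hq1 Hq]]].
(* Bound for the difference between the actual inhomogeneity at step n and c (1 - zeta_n^2) l, the
   one for which c l would be an exact fixed point. *)
set (dd := fun n => Bc * (Rabs (zet n * kappa a n) * (8 * (tau n + tau (S n)))
                    + Rabs (zet n * kappa a n - (1 - zet n ^ 2) * l))).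
assert (Hzk : is_lim_seq (fun n => zet n * kappa a n) (zeta beta_inf * kappa_inf a))
  by (apply is_lim_seq_mult'; [apply zet_lim|apply kappa_inf_lim]).
assert (Hdd : is_lim_seq dd 0).
{ apply lim_0_scal, lim_0_plus.
  - apply lim_0_mult with (Rabs (zeta beta_inf * kappa_inf a)).
    + apply (is_lim_seq_abs _ (Finite _)), Hzk.
    + apply lim_0_scal, lim_0_plus; [exact Htau|]. apply (is_lim_seq_incr_1 tau), Htau.
  - apply (proj1 (is_lim_seq_abs_0 _)).
    replace (Finite 0) with (Finite (zeta beta_inf * kappa_inf a - (1 - zeta beta_inf * zeta beta_inf) * l)).
    + apply is_lim_seq_minus'; [exact Hzk|].
      apply is_lim_seq_mult'; [|apply is_lim_seq_const].
      apply is_lim_seq_minus'; [apply is_lim_seq_const|].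
      apply is_lim_seq_ext with (fun n => zet n * zet n); [intros; ring|].
      apply is_lim_seq_mult'; apply zet_lim.
    + f_equal. rewrite growing_fixed_point by exact h1. fold l. ring. }
(* A majorant of |X - c l| that does not depend on z; the uniformity on [D] comes from here. *)
set (y := fix y m := match m with O => BX + Bc * Rabs l | S m => q ^ 2 * y m + dd (N + m)%nat end).
assert (Hy : is_lim_seq y 0).
{ apply lim_recursion with (rho := q ^ 2) (d := fun m => dd (N + m)%nat); [nra|nra| |reflexivity].
  apply is_lim_seq_ext with (fun n => dd (n + N)%nat); [intros n; f_equal; lia|].
  apply (is_lim_seq_incr_n dd N), Hdd. }
assert (HY : forall m z, D z -> Cmod (X (N + m)%nat z - c z * RtoC l) <= y m).
{ intros m z hz. induction m as [|m IH].
  - rewrite Nat.add_0_r. unfold Cminus. apply Rle_trans with (1 := Cmod_triangle _ _).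
    rewrite Cmod_opp, Cmod_mult, Cmod_R. simpl. apply Rplus_le_compat; [apply HX, hz|].
    apply Rmult_le_compat_r; [apply Rabs_pos|apply Hc, hz].
  - replace (N + S m)%nat with (S (N + m)) by lia.
    change (y (S m)) with (q ^ 2 * y m + dd (N + m)%nat).
    set (n := (N + m)%nat) in *. rewrite HS by (assumption || (unfold n; lia)).
    replace (RtoC (zet n ^ 2) * X n z + c z * (RtoC (zet n * kappa a n) * / (u n z * u (S n) z)) - c z * RtoC l)%C
      with (RtoC (zet n ^ 2) * (X n z - c z * RtoC l) +
        c z * (RtoC (zet n * kappa a n) * (/ (u n z * u (S n) z) - 1)
               + RtoC (zet n * kappa a n - (1 - zet n ^ 2) * l)))%C.
    2:{ rewrite RtoC_minus, (RtoC_mult _ l), (RtoC_minus 1). ring. }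
    apply Rle_trans with (1 := Cmod_triangle _ _). rewrite !Cmod_mult.
    apply Rplus_le_compat.
    + apply Rmult_le_compat; try apply Cmod_ge_0; [|exact IH].
      rewrite Cmod_R, <- RPow_abs. apply pow_incr. split; [apply Rabs_pos|apply Hq; unfold n; lia].
    + unfold dd. apply Rmult_le_compat; try apply Cmod_ge_0; [apply Hc, hz|].
      apply Rle_trans with (1 := Cmod_triangle _ _). rewrite Cmod_mult, !Cmod_R.
      apply Rplus_le_compat_r, Rmult_le_compat_l; [apply Rabs_pos|].
      apply inv_mult_near_1; (apply Hu || apply tau2); try assumption; unfold n; lia. }
(* From X u - c l = X (u - 1) + (X - c l), with |X| <= y + Bc |l|. *)
exists (fun n => (y (n - N)%nat + Bc * Rabs l) * tau n + y (n - N)%nat).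
assert (Hy' : is_lim_seq (fun n => y (n - N)%nat) 0).
{ apply (is_lim_seq_incr_n _ N). apply is_lim_seq_ext with (2 := Hy). intros n. f_equal. lia. }
split.
- apply lim_0_plus; [|exact Hy']. apply lim_0_mult with (0 + Bc * Rabs l); [|exact Htau].
  apply is_lim_seq_plus'; [exact Hy'|apply is_lim_seq_const].
- intros n z hn hz.
  assert (A := HY (n - N)%nat z hz). replace (N + (n - N))%nat with n in A by lia.
  replace (X n z * u n z - c z * RtoC l)%C with
    ((X n z - c z * RtoC l + c z * RtoC l) * (u n z - 1) + (X n z - c z * RtoC l))%C by ring.
  apply Rle_trans with (1 := Cmod_triangle _ _). apply Rplus_le_compat; [|exact A].
  rewrite Cmod_mult. apply Rmult_le_compat; try apply Cmod_ge_0; [|apply Hu; assumption].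
  apply Rle_trans with (1 := Cmod_triangle _ _). apply Rplus_le_compat; [exact A|].
  rewrite Cmod_mult, Cmod_R. apply Rmult_le_compat_r; [apply Rabs_pos|apply Hc, hz].
Qed.

(** The recursion forgets its initial value, so v has to be controlled at one index only. That index
    depends on z0 through [tau], and therefore local boundedness is asked of v at all indices from M
    on. *)
Lemma growing_solution_limit (f v : Z -> C -> C) (K : C -> Prop) (c : C -> C) (M : nat) :
  1 < Rabs beta_inf -> locally_uniform_jost f -> compact_C K ->
  (forall z, K z -> forall n : nat, (M <= n)%nat ->
     wronskian_at a n (fun n => f n z) (fun n => v n z) = c z) ->
  locally_bounded_on K c ->
  (forall n : nat, (M <= n)%nat -> locally_bounded_on K (v n)) ->
  cvg_uniform_on K (fun n z => RtoC (sqrt (a n) * Theta a b N0 n) * v n z)%C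
    (fun z => c z * RtoC (kappa_inf a / (2 * root beta_inf)))%C.
Proof.
intros h1 Hf HK HW Hc Hv eps heps.
apply (compact_eventually K (fun n z => Cmod (RtoC (sqrt (a n) * Theta a b N0 n) * v n z
  - c z * RtoC (kappa_inf a / (2 * root beta_inf))) < eps) HK).
intros z0 hz0.
destruct (Hf z0) as [N1 [tau [hN1 [Htau Hu]]]].
destruct (proj2 (is_lim_seq_spec _ _) Htau (mkposreal (/ 2) ltac:(lra))) as [N2 HN2].
set (N := (N1 + N2 + M)%nat).
destruct (Hc z0 hz0) as [rc [Bc [hrc HBc]]].
destruct (Hv N ltac:(unfold N; lia) z0 hz0) as [rv [Bv [hrv HBv]]].
assert (hz00 : Cmod (z0 - z0) = 0) by (replace (z0 - z0)%C with (RtoC 0) by ring; apply Cmod_0).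
set (r := Rmin 1 (Rmin rc rv)).
assert (hr : 0 < r) by (repeat apply Rmin_glb_lt; lra).
set (D := fun z => K z /\ Cmod (z - z0) < r).
assert (Dr : forall z, D z -> Cmod (z - z0) < 1 /\ Cmod (z - z0) < rc /\ Cmod (z - z0) < rv).
{ intros z [_ hz]. unfold r in hz.
  generalize (Rmin_l 1 (Rmin rc rv)) (Rmin_r 1 (Rmin rc rv)) (Rmin_l rc rv) (Rmin_r rc rv). lra. }
assert (tau2 : forall n, (N <= n)%nat -> tau n <= / 2).
{ intros n hn. generalize (HN2 n ltac:(unfold N in hn; lia)). simpl. rewrite Rminus_0_r.
  generalize (Rle_abs (tau n)). lra. }
assert (HU : forall n z, (N <= n)%nat -> D z -> Cmod (scale n * f n z - 1) <= tau n).
{ intros n z hn hz. apply Hu; [apply Dr, hz|unfold N in hn; lia]. }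
assert (HU2 : forall n z, (N <= n)%nat -> D z -> / 2 <= Cmod (scale n * f n z)).
{ intros n z hn hz. generalize (HU n z hn hz) (tau2 n hn) (Cmod_triangle (scale n * f n z) (- (scale n * f n z - 1))).
  rewrite Cmod_opp. replace (scale n * f n z + - (scale n * f n z - 1))%C with (RtoC 1) by ring.
  rewrite Cmod_1. lra. }
assert (f0 : forall n z, (N <= n)%nat -> D z -> f n z <> 0).
{ intros n z hn hz E. generalize (HU2 n z hn hz). rewrite E, Cmult_0_r, Cmod_0. lra. }
assert (sc0 : forall n, (N <= n)%nat -> RtoC (scale n) <> 0)
  by (intros n hn; apply RtoC_neq_0, scale_neq_0; unfold N in hn; lia).
(* The bound of the initial value uses |scale f| >= 1/2, that is 1/|f| <= 2 |scale|. *)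
destruct (growing_recursion_limit D N (fun n z => scale n * f n z)%C
   (fun n z => RtoC (Theta a b N0 n ^ 2) * v n z / f n z)%C tau c Bc
   (Theta a b N0 N ^ 2 * Bv * (2 * Rabs (scale N)))) as [d [Hd Hlim]];
  [exact h1|unfold N; lia|exact Htau|exact tau2|exact HU| | | | |].
- apply Rle_trans with (2 := HBc z0 hz0 ltac:(lra)), Cmod_ge_0.
- intros z hz. apply HBc; [apply hz|apply Dr, hz].
- intros z hz. rewrite Cmod_div by (apply f0; [lia|exact hz]).
  rewrite Cmod_mult, Cmod_R, (Rabs_pos_eq (_ ^ 2)) by apply pow2_ge_0.
  assert (H2 := HU2 N z ltac:(lia) hz). rewrite Cmod_mult, Cmod_R in H2.
  assert (hf : 0 < Cmod (f N z)) by (apply Cmod_gt_0, f0; [lia|exact hz]).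
  unfold Rdiv. apply Rmult_le_compat.
  + apply Rmult_le_pos; [apply pow2_ge_0|apply Cmod_ge_0].
  + left. apply Rinv_0_lt_compat, hf.
  + apply Rmult_le_compat_l; [apply pow2_ge_0|]. apply HBv; [apply hz|apply Dr, hz].
  + apply Rmult_le_reg_r with (Cmod (f N z)); [exact hf|]. rewrite Rinv_l by lra. lra.
- intros n z hn hz.
  assert (W := HW z (proj1 hz) n ltac:(unfold N in hn; lia)).
  unfold wronskian_at in W. replace (n + 1)%Z with (Z.of_nat (S n)) in W by lia.
  rewrite <- W.
  assert (fn := f0 n z hn hz). assert (fn1 := f0 (S n) z ltac:(lia) hz).
  rewrite Theta_S by (unfold N in hn; lia). rewrite kappa_sqrt. unfold scale.
  assert (t0 := Theta_neq_0 n ltac:(unfold N in hn; lia)).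
  assert (p0 := zet_neq_0 n ltac:(unfold N in hn; lia)).
  assert (x0 := sqrt_a_pos n). assert (y0 := sqrt_a_pos (S n)).
  rewrite Theta_S by (unfold N in hn; lia).
  assert (ea : a n = sqrt (a n) * sqrt (a n)) by (symmetry; apply sqrt_sqrt; left; apply a_pos; lia).
  rewrite ea at 1.
  set (x := sqrt (a n)) in *. set (y := sqrt (a (S n))) in *. set (t := Theta a b N0 n) in *. set (p := zet n) in *.
  assert (x0' : RtoC x <> 0) by (apply RtoC_neq_0; lra).
  assert (y0' : RtoC y <> 0) by (apply RtoC_neq_0; lra).
  assert (t0' := RtoC_neq_0 _ t0). assert (p0' := RtoC_neq_0 _ p0).
  rewrite !RtoC_div by (try apply Rmult_integral_contrapositive_currified; lra).
  rewrite !RtoC_pow, !RtoC_mult, !RtoC_div by lra. field.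
  repeat split; assumption.
- exists r. destruct (proj2 (is_lim_seq_spec _ _) Hd (mkposreal _ heps)) as [N3 HN3].
  exists (N + N3)%nat. split; [exact hr|]. intros n z hn hz hzr.
  assert (hD : D z) by (split; assumption).
  apply Rle_lt_trans with (d n).
  + apply Rle_trans with (2 := Hlim n z ltac:(lia) hD). right. f_equal. f_equal.
    unfold scale. assert (fn := f0 n z ltac:(lia) hD).
    assert (t0 := Theta_neq_0 n ltac:(unfold N in hn; lia)). assert (t0' := RtoC_neq_0 _ t0).
    rewrite RtoC_div, RtoC_pow, RtoC_mult by exact t0. field. split; assumption.
  + generalize (HN3 n ltac:(lia)). simpl. rewrite Rminus_0_r. generalize (Rle_abs (d n)). lra.
Qed.

(** * The second solution, the polynomials and their limits *)

Lemma second_solution_step (N1 n : nat) (f : Z -> C) : (N1 + 1 <= n)%nat ->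
  sum_n_m (fun m : nat => / (a (m - 1)%Z * f (m - 1)%Z * f m))%C (N1 + 1) (S n) =
  (sum_n_m (fun m : nat => / (a (m - 1)%Z * f (m - 1)%Z * f m))%C (N1 + 1) n
   + / (a n * f n * f (S n)))%C.
Proof.
intros hn. rewrite sum_n_Sm by lia. replace (S n - 1)%Z with (Z.of_nat n) by lia. reflexivity.
Qed.

(** Reduction of order: in the Jacobi equation at n + 1 the increments of the sum on the two sides
    contribute -1/f_(n+1) and 1/f_(n+1), which cancel. The threshold is N1 + 2 because the equation
    there involves the index N1 + 1, where the sum starts. *)
Lemma second_solution_exists (z : C) (N1 : nat) (f : Z -> C) :
  jacobi_solution a b z f -> (forall n : nat, (N1 <= n)%nat -> f n <> RtoC 0) ->
  exists g : Z -> C, second_solution a b z N1 f g /\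
    forall g' : Z -> C, second_solution a b z N1 f g' ->
      forall n : Z, (-1 <= n)%Z -> g' n = g n.
Proof.
intros Hf f0.
destruct (jacobi_backward_extension z (N1 + 2) (fun k => f k *
  sum_n_m (fun m : nat => / (a (m - 1)%Z * f (m - 1)%Z * f m)) (N1 + 1) (Z.to_nat k))%C) as [g [Hg1 Hg2]].
{ intros k hk.
  replace k with (Z.of_nat (S (Z.to_nat (k - 1)))) by lia.
  assert (hn : (N1 + 1 <= Z.to_nat (k - 1))%nat) by lia.
  revert hn. generalize (Z.to_nat (k - 1)). clear k hk. intros n hn.
  assert (J := Hf (S n) ltac:(lia)).
  replace (S n - 1)%Z with (Z.of_nat n) in * by lia.
  replace (S n + 1)%Z with (Z.of_nat (S (S n))) in * by lia.
  rewrite !Nat2Z.id, (second_solution_step N1 (S n)), (second_solution_step N1 n) by lia.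
  set (s := sum_n_m _ _ _).
  transitivity ((a n * f n + b (S n) * f (S n) + a (S n) * f (S (S n))) * (s + / (a n * f n * f (S n))))%C.
  - field. repeat split; try (apply f0; lia); apply a_neq_0; lia.
  - rewrite J. ring. }
assert (Hg : second_solution a b z N1 f g).
{ split; [exact Hg1|]. intros n hn. rewrite Hg2 by lia. rewrite Nat2Z.id. reflexivity. }
exists g. split; [exact Hg|]. intros g' [Hg'1 Hg'2].
apply (jacobi_eventually_eq z g' g (N1 + 1) Hg'1 Hg1).
intros n hn. rewrite Hg'2 by exact hn. symmetry. apply (proj2 Hg), hn.
Qed.

Lemma wronskian_second_solution (z : C) (N1 : nat) (f g : Z -> C) :
  (forall n : nat, (N1 <= n)%nat -> f n <> RtoC 0) -> second_solution a b z N1 f g ->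
  forall n : nat, (N1 + 1 <= n)%nat -> wronskian_at a n f g = 1.
Proof.
intros f0 [_ Hg] n hn. unfold wronskian_at.
replace (n + 1)%Z with (Z.of_nat (S n)) by lia.
rewrite !Hg, second_solution_step by lia. set (s := sum_n_m _ _ _).
field. repeat split; try (apply f0; lia). apply a_neq_0. lia.
Qed.

(** From N1 + 1 on, g is a finite expression in values of f and their inverses, and these values do
    not vanish on [K]. *)
Lemma second_solution_locally_bounded (K : C -> Prop) (N1 : nat) (f g : Z -> C -> C) :
  (forall n : Z, (-1 <= n)%Z -> entire (f n)) ->
  (forall z, K z -> forall n : nat, (N1 <= n)%nat -> f n z <> RtoC 0) ->
  (forall z, K z -> second_solution a b z N1 (fun n => f n z) (fun n => g n z)) ->
  forall n : nat, (N1 + 1 <= n)%nat -> locally_bounded_on K (g n).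
Proof.
intros He f0 Hg n hn.
assert (Hb : locally_bounded_on K (fun z => f n z *
  sum_n_m (fun m : nat => / (a (m - 1)%Z * f (m - 1)%Z z * f m z)) (N1 + 1) n)%C).
{ apply locally_bounded_on_mult; [apply locally_bounded_on_entire, He; lia|].
  assert (Ht : forall m : nat, (N1 + 1 <= m)%nat ->
    locally_bounded_on K (fun z => / a (m - 1)%Z * / f (m - 1)%Z z * / f m z)%C).
  { intros m hm. apply locally_bounded_on_mult; [apply locally_bounded_on_mult|].
    - apply locally_bounded_on_const.
    - apply locally_bounded_on_inv; [apply He; lia|]. intros z hz.
      replace (m - 1)%Z with (Z.of_nat (m - 1)) by lia. apply f0; [exact hz|lia].
    - apply locally_bounded_on_inv; [apply He; lia|]. intros z hz. apply f0; [exact hz|lia]. }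
  assert (Ht' : forall m : nat, (N1 + 1 <= m)%nat ->
    locally_bounded_on K (fun z => / (a (m - 1)%Z * f (m - 1)%Z z * f m z))%C).
  { intros m hm. apply locally_bounded_on_ext with (2 := Ht m hm). intros z hz.
    field. repeat split; [apply f0; [exact hz|lia]| |apply a_neq_0; lia].
    replace (m - 1)%Z with (Z.of_nat (m - 1)) by lia. apply f0; [exact hz|lia]. }
  induction n as [|n IH]; [lia|].
  destruct (Nat.eq_dec (N1 + 1) (S n)) as [e|ne].
  - rewrite <- e. apply locally_bounded_on_ext with (2 := Ht' (N1 + 1)%nat (Nat.le_refl _)).
    intros z _. rewrite sum_n_n. reflexivity.
  - apply locally_bounded_on_ext with (2 := locally_bounded_on_plus K _ _ (IH ltac:(lia)) (Ht' (S n) hn)).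
    intros z _. rewrite sum_n_Sm by lia. reflexivity. }
apply locally_bounded_on_ext with (2 := Hb).
intros z hz. symmetry. apply (proj2 (Hg z hz) n hn).
Qed.

(** Written with sums, products and constants only, the operations under which local boundedness has
    been shown to persist. *)
Lemma P_next (n : nat) (z : C) :
  P a b (S n) z = (/ a n * ((z + - b n) * P a b n z + - a (n - 1)%Z * P a b (n - 1)%Z z))%C.
Proof.
generalize (P_solution a b z a_pos n ltac:(lia)).
replace (n + 1)%Z with (Z.of_nat (S n)) by lia. intros E.
apply Cmult_eq_reg_l with (RtoC (a n)); [|apply a_neq_0; lia].
transitivity ((z + - b n) * P a b n z + - a (n - 1)%Z * P a b (n - 1)%Z z)%C.
- transitivity (a (n - 1)%Z * P a b (n - 1)%Z z + b n * P a b n z + a n * P a b (S n) z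
    - b n * P a b n z - a (n - 1)%Z * P a b (n - 1)%Z z)%C; [ring|]. rewrite E. ring.
- field. apply a_neq_0; lia.
Qed.

Lemma P_locally_bounded (K : C -> Prop) (n : nat) : locally_bounded_on K (P a b n).
Proof.
assert (H : locally_bounded_on K (P a b (n - 1)%Z) /\ locally_bounded_on K (P a b n)).
{ induction n as [|n [IH1 IH2]].
  - split; [exact (locally_bounded_on_const K 0)|exact (locally_bounded_on_const K 1)].
  - replace (S n - 1)%Z with (Z.of_nat n) by lia. split; [exact IH2|].
    assert (Hb : locally_bounded_on K
      (fun z => / a n * ((z + - b n) * P a b n z + - a (n - 1)%Z * P a b (n - 1)%Z z))%C).
    { repeat first [exact IH1 | exact IH2 | apply locally_bounded_on_const | apply locally_bounded_on_id
        | apply locally_bounded_on_mult | apply locally_bounded_on_plus]. }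
    apply locally_bounded_on_ext with (2 := Hb). intros z _. symmetry. apply P_next. }
apply H.
Qed.

Lemma locally_uniform_jost_neq_0 (f : Z -> C -> C) (K : C -> Prop) :
  locally_uniform_jost f -> compact_C K ->
  exists N1 : nat, forall z : C, K z -> forall n : nat, (N1 <= n)%nat -> f n z <> RtoC 0.
Proof.
intros Hf HK.
destruct (compact_eventually K (fun n z => f n z <> RtoC 0) HK) as [N HN].
- intros z0 _. destruct (Hf z0) as [N [tau [_ [Htau H]]]].
  destruct (proj2 (is_lim_seq_spec _ _) Htau (mkposreal 1 Rlt_0_1)) as [N2 HN2].
  exists 1, (N + N2)%nat. split; [lra|]. intros n z hn _ hz E.
  generalize (H z hz n ltac:(lia)) (HN2 n ltac:(lia)). rewrite E. simpl.
  replace (scale n * 0 - 1)%C with (- (1))%C by ring. rewrite Cmod_m1, Rminus_0_r.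
  generalize (Rle_abs (tau n)). lra.
- exists N. intros z hz n hn. apply HN; assumption.
Qed.

Lemma second_solution_limit (f g : Z -> C -> C) (K : C -> Prop) (N1 : nat) :
  1 < Rabs beta_inf -> locally_uniform_jost f -> (forall n : Z, (-1 <= n)%Z -> entire (f n)) ->
  compact_C K -> (forall z, K z -> forall n : nat, (N1 <= n)%nat -> f n z <> RtoC 0) ->
  (forall z, K z -> second_solution a b z N1 (fun n => f n z) (fun n => g n z)) ->
  cvg_uniform_on K (fun n z => RtoC (sqrt (a n) * Theta a b N0 n) * g n z)%C
    (fun _ => RtoC (kappa_inf a / (2 * root beta_inf))).
Proof.
intros h1 Hf He HK f0 Hg eps heps.
destruct (growing_solution_limit f g K (fun _ => 1) (N1 + 1) h1 Hf HK) with (eps := eps) as [N HN].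
- intros z hz. apply (wronskian_second_solution z N1 (fun n => f n z) (fun n => g n z)); auto.
- apply locally_bounded_on_const.
- apply second_solution_locally_bounded with f; assumption.
- exact heps.
- exists N. intros n hn z hz. generalize (HN n hn z hz). rewrite Cmult_1_l. auto.
Qed.

Lemma P_limit (f : Z -> C -> C) (K : C -> Prop) :
  1 < Rabs beta_inf -> locally_uniform_jost f -> (forall n : Z, (-1 <= n)%Z -> entire (f n)) ->
  (forall z, jacobi_solution a b z (fun n => f n z)) -> compact_C K ->
  cvg_uniform_on K (fun n z => RtoC (sqrt (a n) * Theta a b N0 n) * P a b n z)%C
    (fun z => - (RtoC (kappa_inf a) * Omega a b f z / RtoC (2 * root beta_inf)))%C.
Proof.
intros h1 Hf He Jf HK eps heps.
(* The constant is {f, P} = -Omega, read off at n = -1, where P_(-1) = 0 and P_0 = 1. *)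
destruct (growing_solution_limit f (fun n z => P a b n z) K (fun z => a (-1)%Z * f (-1)%Z z)%C O h1 Hf HK)
  with (eps := eps) as [N HN].
- intros z hz n _.
  rewrite (wronskian_at_const a b z _ _ (Jf z) (P_solution a b z a_pos)) by lia.
  unfold wronskian, wronskian_at.
  change (P a b (-1 + 1) z) with (RtoC 1). change (P a b (-1) z) with (RtoC 0). ring.
- apply locally_bounded_on_mult; [apply locally_bounded_on_const|].
  apply locally_bounded_on_entire, He. lia.
- intros n _. apply P_locally_bounded.
- exact heps.
- exists N. intros n hn z hz. generalize (HN n hn z hz). rewrite Omega_eq.
  assert (hr : 2 * root beta_inf <> 0).
  { intros E. assert (root beta_inf = 0) by lra.
    generalize (zeta_mult _ h1). unfold zeta. rewrite H. intros E1.
    assert (beta_inf ^ 2 = 1) by lra. rewrite <- pow2_abs in H0. nra. }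
  rewrite RtoC_div by exact hr.
  replace (- (kappa_inf a * - (a (-1)%Z * f (-1)%Z z) / (2 * root beta_inf)%R))%C with
    (a (-1)%Z * f (-1)%Z z * (kappa_inf a / (2 * root beta_inf)%R))%C; [auto|].
  field. apply RtoC_neq_0, hr.
Qed.

Lemma P_subordinate_limit (f : Z -> C -> C) (z : C) (N1 : nat) (g : Z -> C) :
  jacobi_solution a b z (fun n => f n z) -> jost_asymptotics a b N0 (fun n => f n z) ->
  (forall n : nat, (N1 <= n)%nat -> f n z <> RtoC 0) ->
  second_solution a b z N1 (fun n => f n z) g -> Omega a b f z = RtoC 0 ->
  filterlim (fun n : nat => RtoC (sqrt (a n) * / Theta a b N0 n) * P a b n z)%C
    eventually (locally (wronskian a (fun n => P a b n z) g)) /\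
  wronskian a (fun n => P a b n z) g <> RtoC 0.
Proof.
intros Jf Af f0 Hg HO.
set (c := wronskian a (fun n => P a b n z) g).
assert (JP := P_solution a b z a_pos).
assert (Ec : forall n : nat, (N1 + 1 <= n)%nat -> P a b n z = (c * f n z)%C).
{ intros n hn.
  assert (W1 := wronskian_second_solution z N1 _ g f0 Hg n hn).
  assert (W2 := wronskian_at_const a b z _ _ JP (proj1 Hg) n ltac:(lia)). fold c in W2.
  assert (W3 := wronskian_at_const a b z _ _ JP Jf n ltac:(lia)).
  change (wronskian a (fun n => P a b n z) (fun n => f n z)) with (Omega a b f z) in W3.
  rewrite HO in W3. unfold wronskian_at in W1, W2, W3.
  rewrite <- (Cmult_1_l (P a b n z)), <- W1, <- W2.
  (* The identity P {f, g} = {P, g} f - {P, f} g, where {f, g} = 1 and {P, f} = Omega = 0. *)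
  transitivity (a n * (P a b n z * g (n + 1)%Z - P a b (n + 1)%Z z * g n) * f n z
    - (a n * (P a b n z * f (n + 1)%Z z - P a b (n + 1)%Z z * f n z)) * g n)%C; [ring|].
  rewrite W3. ring. }
split.
- rewrite <- (Cmult_1_r c).
  apply (clim_ext (fun n : nat => c * (scale n * f n z))%C _ _ (N1 + 1)).
  + intros n hn. rewrite Ec by exact hn. unfold scale, Rdiv. ring.
  + apply clim_scal, (proj1 (jost_asymptotics_iff (fun n => f n z))), Af.
(* If {P, g} were 0, P would vanish for large n, hence by backward recursion at n = 0, where it
   equals 1. *)
- intros E0.
  assert (J0 : jacobi_solution a b z (fun _ => RtoC 0)) by (intros n _; ring).
  assert (H0 := jacobi_eventually_eq z _ _ (N1 + 1) JP J0
    (fun n hn => eq_trans (Ec n hn) (eq_trans (f_equal (fun w => w * f n z)%C E0) (Cmult_0_l _))) 0%Z ltac:(lia)).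
  simpl in H0. apply RtoC_inj in H0. lra.
Qed.

End Coefficients.

Theorem theorem7p1
  (a b : Z -> R) (beta_inf : R) (N0 : nat)
  (a_pos : forall n : Z, (-1 <= n)%Z -> 0 < a n)
  (a_inv_summable : ex_series (fun n : nat => / a n))
  (a_infty : is_lim_seq (fun n : nat => a n) p_infty)
  (beta_lim : is_lim_seq (fun n : nat => beta a b n) beta_inf)
  (beta_inf_gt1 : 1 < Rabs beta_inf)
  (k_ell1 : ell1 (fun n : nat => kk a n - 1))
  (beta'_ell1 : ell1 (fun n : nat => beta a b (n + 1)%Z - beta a b n))
  (hN0 : admissible_N0 a b beta_inf N0) :
  ex_finite_lim_seq (fun n : nat => kappa a n) /\
  exists f : Z -> C -> C,
    (* existence and uniqueness of the solution f_n(z) *)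
    (forall z : C,
       jacobi_solution a b z (fun n => f n z) /\
       jost_asymptotics a b N0 (fun n => f n z) /\
       forall u : Z -> C,
         jacobi_solution a b z u -> jost_asymptotics a b N0 u ->
         forall n : Z, (-1 <= n)%Z -> u n = f n z) /\
    (* g_n(z) is well defined, with a common N1 on compact sets *)
    (forall K : C -> Prop, compact_C K ->
       exists N1 : nat, forall z : C, K z ->
         forall n : nat, (N1 <= n)%nat -> f n z <> RtoC 0) /\
    (forall (z : C) (N1 : nat),
       (forall n : nat, (N1 <= n)%nat -> f n z <> RtoC 0) ->
       exists g : Z -> C,
         second_solution a b z N1 (fun n => f n z) g /\
         forall g' : Z -> C,
           second_solution a b z N1 (fun n => f n z) g' ->
           forall n : Z, (-1 <= n)%Z -> g' n = g n) /\
    (* asymptotics of g_n(z) *)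
    (forall (K : C -> Prop) (N1 : nat) (g : Z -> C -> C), compact_C K ->
       (forall z : C, K z -> forall n : nat, (N1 <= n)%nat -> f n z <> RtoC 0) ->
       (forall z : C, K z ->
          second_solution a b z N1 (fun n => f n z) (fun n => g n z)) ->
       cvg_uniform_on K
         (fun n z => RtoC (sqrt (a n) * Theta a b N0 n) * g n z)%C
         (fun _ => RtoC (kappa_inf a / (2 * root beta_inf)))) /\
    (* asymptotics of P_n(z) *)
    (forall K : C -> Prop, compact_C K ->
       cvg_uniform_on K
         (fun n z => RtoC (sqrt (a n) * Theta a b N0 n) * P a b n z)%C
         (fun z => - (RtoC (kappa_inf a) * Omega a b f z
                      / RtoC (2 * root beta_inf)))%C) /\
    (* the case Omega(z) = 0 *)
    (forall (z : C) (N1 : nat) (g : Z -> C),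
       (forall n : nat, (N1 <= n)%nat -> f n z <> RtoC 0) ->
       second_solution a b z N1 (fun n => f n z) g ->
       Omega a b f z = RtoC 0 ->
       filterlim
         (fun n : nat => RtoC (sqrt (a n) * / Theta a b N0 n) * P a b n z)%C
         eventually (locally (wronskian a (fun n => P a b n z) g)) /\
       wronskian a (fun n => P a b n z) g <> RtoC 0) /\
    (* analyticity in z *)
    (forall n : Z, (-1 <= n)%Z -> entire (f n)).
Proof.
destruct (jost_family a b beta_inf N0 a_pos a_inv_summable beta_lim k_ell1 beta'_ell1 hN0)
  as [f [Jf [Af [Ef Uf]]]].
split.
{ destruct (kappa_lim_pos a a_pos k_ell1) as [l [_ Hl]]. exists l. exact Hl. }
exists f. repeat split.
- apply Jf.
- apply Af.
- intros u Ju Au. apply (jost_unique a b beta_inf N0 a_pos beta_lim k_ell1 hN0 z); auto.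
- intros K HK. eapply locally_uniform_jost_neq_0; eassumption.
- intros z N1 f0. apply second_solution_exists; [exact a_pos|apply Jf|exact f0].
- intros K N1 g HK f0 Hg. eapply second_solution_limit with (f := f); eassumption.
- intros K HK. eapply P_limit; eassumption.
- eapply P_subordinate_limit; try eassumption; auto.
- eapply P_subordinate_limit; try eassumption; auto.
- exact Ef.
Qed.
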